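(* Let $M\ge 2$ and $n\ge 2$ be integers, let $\delta\in(0,1)$, let $(\mathcal X,\mu)$ be a measure space, let $p_1,\dots,p_M$ be arbitrary probability densities on $\mathcal X$ with respect to $\mu$, and let $\mathcal P=\operatorname{conv}\{p_1,\dots,p_M\}$ be the set of all mixtures $\sum_{j=1}^M\theta_jp_j$ with $\theta_j\ge 0$, $\sum_{j=1}^M\theta_j=1$. There exists a density estimator $\widehat p=\widehat p(X_1,\dots,X_n)$ such that for every $p^\star\in\mathcal P$, if $X_1,\dots,X_n$ are i.i.d. with density $p^\star$, then with probability at least $1-\delta$, $$\mathrm{KL}(p^\star,\widehat p)\le \frac{870030\,M+45000\log(M)\log(4/\delta)}{n}.$$
   Context: For probability densities $p,q$ on $(\mathcal X,\mu)$, $\mathrm{KL}(p,q)=\int_{\mathcal X}p\log(p/q)\,d\mu\in[0,+\infty]$ (equal to $+\infty$ if $p$ is not absolutely continuous with respect to $q$). A density estimator is a map from samples in $\mathcal X^n$ to probability densities on $(\mathcal X,\mu)$; it may depend on $p_1,\dots,p_M$, $n$ and $\delta$, but not on $p^\star$. No assumption is made on the densities $p_j$: ratios may be unbounded and supports may differ. $\log$ is the natural logarithm. *)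

(* Defs.v *)
From HB Require Import structures.
From mathcomp Require Import all_boot all_order all_algebra.
From mathcomp Require Import all_classical all_reals all_analysis.

Set Implicit Arguments.
Unset Strict Implicit.
Unset Printing Implicit Defensive.

Import Order.TTheory GRing.Theory Num.Theory.
Import numFieldNormedType.Exports.

Local Open Scope classical_set_scope.
Local Open Scope ring_scope.

Section densities.
Context (R : realType) (d : measure_display) (X : measurableType d)
  (mu : {measure set X -> \bar R}).
Implicit Types p q : X -> R.

Definition is_density p : Prop :=
  [/\ measurable_fun setT p, (forall x, 0 <= p x) &
      (\int[mu]_x (p x)%:E = 1)%E].

Definition density_law p (A : set X) : \bar R := (\int[mu]_(x in A) (p x)%:E)%E.

(* The integrand is 0 where p x = 0, which is the convention 0 log 0 = 0; in the
   first branch the points where p x > 0 = q x are mu-null.  The negative part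
   of the integrand is at most q, hence integrable, so the integral is well
   defined in \bar R. *)
Definition KL p q : \bar R :=
  if `[< density_law p `<< density_law q >]
  then (\int[mu]_x (p x * ln (p x / q x))%:E)%E
  else +oo%E.

Definition mixtures (M : nat) (p : 'I_M -> X -> R) : set (X -> R) :=
  [set q | exists theta : 'I_M -> R,
     [/\ forall j, 0 <= theta j, \sum_(j < M) theta j = 1 &
         q = (fun x => \sum_(j < M) theta j * p j x)]].

Definition is_density_estimator (n : nat) (phat : ('I_n -> X) -> X -> R) : Prop :=
  forall s : 'I_n -> X, is_density (phat s).

Definition iid_with_density (d' : measure_display) (Omega : measurableType d')
    (P : probability Omega R) (n : nat) (Xs : 'I_n -> {RV P >-> X}) p : Prop :=
  (forall (i : 'I_n) (A : set X), measurable A ->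
     distribution P (Xs i) A = density_law p A) /\
  (forall A : 'I_n -> set X, (forall i, measurable (A i)) ->
     P (\bigcap_i (Xs i @^-1` A i)) = (\prod_(i < n) P (Xs i @^-1` A i))%E).

End densities.

(* Inner probability: for a measurable event E this says c%:E <= P E. No
   measurability of E is presupposed, because density estimators are arbitrary
   maps. *)
Definition with_probability_ge (R : realType) (d : measure_display)
    (Omega : measurableType d) (P : probability Omega R) (c : R)
    (E : set Omega) : Prop :=
  exists A : set Omega, [/\ measurable A, A `<=` E & (c%:E <= P A)%E].

(* Main.v *)
Require Import Defs.
From HB Require Import structures.
From mathcomp Require Import all_boot all_order all_algebra.
From mathcomp Require Import all_classical all_reals all_analysis.
From mathcomp Require Import measurable_realfun ring lra zify.

Set Implicit Arguments.
Unset Strict Implicit.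
Unset Printing Implicit Defensive.

Import Order.TTheory GRing.Theory Num.Theory.
Import numFieldNormedType.Exports.

Local Open Scope classical_set_scope.
Local Open Scope ring_scope.

(* Write [f_j = p_j / pstar], [F_u = \sum_j u_j f_j] for nonnegative, not
   necessarily normalised [u], and let [h u] be the squared Hellinger distance of
   [F_u * pstar] to [pstar].

   First half of the sample.  Sum [sqrt (lik u)] over a lattice of points [u],
   weighted by [expR (m h(u) / 4)].  Since the midpoint of [u] and [tau] is at
   least as far from the truth as a fixed fraction of [h u] (up to [h tau]),
   concavity bounds that sum below by the fourth root of the likelihood of each
   single [u] times an average over [tau] near the truth, so the usual union
   bound loses [6 ^ M] and no logarithm of [n]: all lattice points of nearly
   maximal likelihood satisfy [m h(u) <= C (M + ln (4 / delta))].

   These points are covered by a net whose relevant point has prior weight at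
   least [2 ^ - O(M)]: relative to a nearly product-maximal point [c] of their
   hull, the truncated coordinate ratios of [u] determine [u] up to a one-sided
   constant factor, and every net point dominates the truth up to a factor [O(M)].

   Second half.  Average the sequential Bayes predictors over the net.  All
   density ratios exceed [B^-1] with [B = 64 M], so [- ln] is controlled by a
   power [eta] of order [1 / ln M], and the Bayes mixture gives a
   supermartingale whose Markov bound costs [ln M * ln (4 / delta)], while the
   prior costs only [O(M)]. *)

(** * Elementary inequalities *)

(** The obstacle is [M * ln n], the cost of a union bound over a lattice of spacing [1 / (n * M)].
    It disappears because one unknown quantity, [lattice_weight], occurs twice: up to [6 ^ M] it
    bounds the mean of the sum of square-root likelihoods from above, and through Cauchy-Schwarz it
    bounds the average over [tau] from below. It cancels without being estimated. The fourth roots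
    come from pairing [u] with [tau]: by AM-GM two of them are dominated by one square root at the
    midpoint, whose mean decays like [expR (- m h / 2)]. The average over [tau] needs a negative
    moment of the likelihood of [tau], which is controlled for mixtures bounded below relative to
    the truth. The 6 is 2 for halves, in midpoints, times 3 for thirds, in convex combinations with
    the rounded truth. The net depends on the data through a set with finitely many values that is
    fixed by the first half, so the second half is treated on each value separately and no union
    over nets is paid. *)

Section real_inequalities.
Context {R : realType}.
Implicit Types s t w x y z B : R.

(** Since [s ^+ 2 = 2 * w ^+ 2 - t ^+ 2], closeness of [w] and [t] to 1 forces closeness of [s] to
    1. Expanding around 1, Cauchy-Schwarz bounds the linear part by [9 / 2 * d], and the radius
    [5 * d] absorbs the quadratic terms. *)
Lemma sqrt_midpoint_sqr s t w : 0 <= s -> 0 <= t -> 0 <= w ->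
  2 * w ^+ 2 = s ^+ 2 + t ^+ 2 ->
  (s - 1) ^+ 2 <= 25 * ((w - 1) ^+ 2 + (t - 1) ^+ 2).
Proof.
move=> s0 t0 w0 e.
set D := (w - 1) ^+ 2 + (t - 1) ^+ 2.
have D0 : 0 <= D by rewrite addr_ge0// sqr_ge0.
pose d := Num.sqrt D.
have dD : d ^+ 2 = D by rewrite sqr_sqrtr.
have d0 : 0 <= d by exact: sqrtr_ge0.
rewrite -dD (_ : 25 * d ^+ 2 = (5 * d) ^+ 2); last by ring.
rewrite -ler_sqrt ?sqr_ge0// !sqrtr_sqr (ger0_norm (mulr_ge0 _ d0))//.
have lin : `|4 * (w - 1) - 2 * (t - 1)| <= 9 / 2 * d.
  rewrite -ler_sqr ?nnegrE//; last by lra.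
  rewrite real_normK ?num_real// exprMn dD /D.
  have := sqr_ge0 (2 * (w - 1) + 4 * (t - 1)).
  have := sqr_ge0 (w - 1); have := sqr_ge0 (t - 1).
  move: (w - 1) (t - 1) => a b.
  rewrite (_ : (9 / 2) ^+ 2 = 81 / 4); last by field.
  by clear; nra.
have w1 : (w - 1) ^+ 2 <= d ^+ 2 by rewrite dD lerDl sqr_ge0.
have t1 : (t - 1) ^+ 2 <= d ^+ 2 by rewrite dD lerDr sqr_ge0.
move: lin; rewrite !ler_norml => /andP[l1 l2].
have se : s ^+ 2 = 1 + (4 * (w - 1) - 2 * (t - 1)) + 2 * (w - 1) ^+ 2 - (t - 1) ^+ 2.
  by rewrite -[LHS](addrK (t ^+ 2)) -e; ring.
have w2 := sqr_ge0 (w - 1); have t2 := sqr_ge0 (t - 1).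
move: se l1 l2 w1 t1 w2 t2; clear e dD; clearbody d; clear D D0.
move: (4 * _ - 2 * _) ((w - 1) ^+ 2) ((t - 1) ^+ 2) => lin W T se l1 l2 w1 t1 w2 t2.
apply/andP; split; last first.
  suff : s <= 1 + 5 * d by lra.
  rewrite -ler_sqr ?nnegrE//; last by lra.
  by rewrite se; nra.
have [d1|d1] := leP 1 (5 * d); first by lra.
suff : 1 - 5 * d <= s by lra.
rewrite -ler_sqr ?nnegrE//; last by lra.
by rewrite se; nra.
Qed.

Lemma sqrt_midpoint x y : 0 <= x -> 0 <= y ->
  2 * Num.sqrt ((x + y) / 2) <=
  1 + (x + y) / 2 - (1 + x - 2 * Num.sqrt x) / 25 + (1 + y - 2 * Num.sqrt y).
Proof.
move=> x0 y0.
have xy0 : 0 <= (x + y) / 2 by rewrite divr_ge0// addr_ge0.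
have := @sqrt_midpoint_sqr (Num.sqrt x) (Num.sqrt y) (Num.sqrt ((x + y) / 2))
  (sqrtr_ge0 _) (sqrtr_ge0 _) (sqrtr_ge0 _).
rewrite !sqr_sqrtr// => /(_ ltac:(field)).
rewrite !sqrrB1 !sqr_sqrtr//.
move: (Num.sqrt x) (Num.sqrt y) (Num.sqrt _) => a b c.
lra.
Qed.

Lemma sqrt_concave l x y : 0 <= l -> l <= 1 -> 0 <= x -> 0 <= y ->
  l * Num.sqrt x + (1 - l) * Num.sqrt y <= Num.sqrt (l * x + (1 - l) * y).
Proof.
move=> l0 l1 x0 y0.
have sx := sqrtr_ge0 x; have sy := sqrtr_ge0 y.
have m0 : 0 <= 1 - l by lra.
rewrite -ler_sqr ?nnegrE ?sqrtr_ge0 ?addr_ge0 ?mulr_ge0// sqr_sqrtr; last first.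
  by rewrite addr_ge0 ?mulr_ge0.
have := sqr_sqrtr x0; have := sqr_sqrtr y0.
move: (Num.sqrt x) (Num.sqrt y) => a b <- <-.
have : 0 <= l * (1 - l) * (a - b) ^+ 2 by rewrite mulr_ge0 ?sqr_ge0 ?mulr_ge0.
lra.
Qed.

Lemma sqrt_contract x z : 0 <= x -> 2 / 3 + x / 3 <= z ->
  2 / 3 + Num.sqrt x / 3 <= Num.sqrt z.
Proof.
move=> x0 xz.
have s0 := sqrtr_ge0 x.
apply: le_trans (ler_wsqrtr xz).
rewrite -ler_sqr ?nnegrE ?sqrtr_ge0//.
rewrite sqr_sqrtr; last by lra.
have := sqr_sqrtr x0; have := sqr_ge0 (Num.sqrt x - 1).
move: (Num.sqrt x) s0 => s s0; clear xz; nra.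
Qed.

(** Bernoulli reduces the power -1/4 to the power -1. There, with [s = sqrt x] and after
    multiplication by [2 / 3 + x / 3], the gap is exactly [(s - 1) ^+ 2 * (s - 2) ^+ 2 / 18]. *)
Lemma inv_sqrt4_contract x z : 0 <= x -> 2 / 3 + x / 3 <= z ->
  (Num.sqrt (Num.sqrt z))^-1 <=
  1 - (x - 1) / 12 + (1 + x - 2 * Num.sqrt x) / 8.
Proof.
move=> x0 xz.
have z0 : 0 < z by lra.
set q := Num.sqrt (Num.sqrt z).
have q0 : 0 < q by rewrite !sqrtr_gt0.
have q4 : q ^+ 4 = z.
  by rewrite (exprM q 2 2) !sqr_sqrtr// ?sqrtr_ge0// ltW.
have s0 := sqrtr_ge0 x.
pose s := Num.sqrt x; have sx : s ^+ 2 = x by rewrite sqr_sqrtr.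
rewrite -/s in s0 *.
have b1 : q^-1 <= 1 + (q^-1 ^+ 4 - 1) / 4.
  have : 0 <= (q^-1 - 1) ^+ 2 * (q^-1 ^+ 2 + 2 * q^-1 + 3).
    rewrite mulr_ge0 ?sqr_ge0//.
    have : 0 < q^-1 by rewrite invr_gt0.
    nra.
  move: (q^-1) => r; nra.
apply: (le_trans b1).
have b2 : q^-1 ^+ 4 <= (2 / 3 + x / 3)^-1.
  by rewrite exprVn q4 lef_pV2 ?posrE//; lra.
suff : (2 / 3 + x / 3)^-1 <= 1 - (x - 1) / 3 + (1 + x - 2 * s) / 2 by lra.
rewrite -[X in X <= _]mul1r ler_pdivrMr; last by lra.
rewrite -sx.
have : 0 <= (s - 1) ^+ 2 * (s - 2) ^+ 2 by rewrite mulr_ge0 ?sqr_ge0.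
nra.
Qed.

(** Multiplied by [s = sqrt x], the gap is [2 * (s - 1) ^+ 2 * (s - 1 / 2)]: the coefficient [5 / 2]
    is the smallest one valid down to [x = 1 / 4]. *)
Lemma inv_sqrt_quarter x : 1 / 4 <= x ->
  (Num.sqrt x)^-1 <= 1 - (x - 1) / 2 + 5 / 2 * (1 + x - 2 * Num.sqrt x).
Proof.
move=> x4; have x0 : 0 <= x by lra.
set s := Num.sqrt x; have sx : s ^+ 2 = x by rewrite sqr_sqrtr.
have s2 : 1 / 2 <= s.
  rewrite -ler_sqr ?nnegrE ?sqrtr_ge0//; rewrite sx; lra.
rewrite -[X in X <= _]mul1r ler_pdivrMr; last by lra.
rewrite -sx.
have : 0 <= (s - 1) ^+ 2 * (s - 1 / 2) by rewrite mulr_ge0 ?sqr_ge0//; lra.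
nra.
Qed.

Lemma powR_bernoulli eta x : 0 <= eta -> eta <= 1 -> 0 < x ->
  x `^ eta <= 1 + eta * (x - 1).
Proof.
move=> e0 e1 x0; rewrite /powR gt_eqF//.
have i01 : (0 <= eta) && (eta <= 1) by rewrite e0 e1.
have := @convex_expR R (Itv01 e0 e1) (ln x) 0.
rewrite !convRE/= expR0 lnK// mulr0 addr0 mulr1 /unstable.onem => H.
by apply: (le_trans H); rewrite le_eqVlt; apply/orP; left; apply/eqP; ring.
Qed.

Lemma le_oneBV_ln x : 0 < x -> 1 - x^-1 <= ln x.
Proof.
move=> x0; have xV : 0 < x^-1 by rewrite invr_gt0.
have := @le_ln1Dx R (x^-1 - 1) ltac:(lra).
by rewrite addrC subrK lnV// => H; lra.
Qed.

Lemma oneBexpN_lb z : 0 <= z -> z - z ^+ 2 <= 1 - expR (- z).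
Proof.
move=> z0; have e := expR_ge1Dx z.
have e0 := expR_gt0 z.
rewrite expRN.
have : (expR z)^-1 <= (1 + z)^-1 by rewrite lef_pV2 ?posrE//; lra.
have : (1 + z)^-1 <= 1 - z + z ^+ 2.
  rewrite -[X in X <= _]mul1r ler_pdivrMr; last by lra.
  have : 0 <= z ^+ 3 by rewrite exprn_ge0.
  nra.
lra.
Qed.

Lemma expN_quadratic x : 0 <= x -> x ^+ 2 / 4 <= expR (- x) - 1 + x \/ 2 <= x.
Proof.
move=> x0; have [x2|x2] := leP 2 x; first by right.
left; have := expR_ge1Dx (- (x / 2)).
have -> : expR (- x) = expR (- (x / 2)) ^+ 2.
  by rewrite -expRM_natl; congr expR; field.
have := expR_gt0 (- (x / 2)).
nra.
Qed.

(* The factor 3 leaves room for the quadratic term of [f `^ eta] at [f < 1],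
   and makes the remainder at [f > 1] a perfect cube in [sqrt f]. *)
Lemma neg_ln_le_powR B f eta : 1 <= B -> B^-1 <= f ->
  eta * (12 + 6 * ln B) = 1 ->
  - ln f <= 3 / eta * (1 - f `^ eta) + 2 * (f - 1).
Proof.
move=> B1 Bf eB.
have B0 : 0 < B by lra.
have f0 : 0 < f by apply: lt_le_trans Bf; rewrite invr_gt0.
have lB : 0 <= ln B by exact: ln_ge0.
have e0 : 0 < eta.
  by rewrite -(pmulr_lgt0 _ (_ : 0 < 12 + 6 * ln B)) ?eB//; lra.
(* The two summands of [12 + 6 * ln B] serve different regimes: [eta <= 1 / 12] handles the
   quadratic term for [x < 2] and allows the exponent [2 * eta] at [f > 1], while
   [eta * ln B <= 1 / 6] handles [x >= 2]. *)
have e12 : eta <= 1 / 12 by nra.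
have [f1|f1] := leP 1 f; last first.
  pose x := - ln f.
  have x0 : 0 <= x by rewrite oppr_ge0 ln_le0// ltW.
  have xB : x <= ln B.
    rewrite /x -lnV ?posrE// ler_ln ?posrE ?invr_gt0//.
    by rewrite -[leRHS]invrK lef_pV2 ?posrE ?invr_gt0.
  have fe : f = expR (- x) by rewrite /x opprK lnK.
  have pe : f `^ eta = expR (- (eta * x)).
    by rewrite /powR gt_eqF// /x mulrN opprK.
  rewrite pe -/x.
  have := oneBexpN_lb (mulr_ge0 (ltW e0) x0) => q1.
  have q2 : 3 * x - 3 * eta * x ^+ 2 <= 3 / eta * (1 - expR (- (eta * x))).
    rewrite [leRHS]mulrAC ler_pdivlMr//.
    nra.
  have ex : eta * x <= 1 / 6 by nra.
  rewrite [in X in _ <= _ + X]fe.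
  have [q3|q3] := expN_quadratic x0; first by nra.
  have := expR_gt0 (- x); nra.
pose s := Num.sqrt f.
have ss : s ^+ 2 = f by rewrite sqr_sqrtr// ltW.
have s1 : 1 <= s by rewrite -sqrtr1 ler_wsqrtr.
have pb : f `^ eta <= 1 + 2 * eta * (s - 1).
  have -> : f `^ eta = s `^ (2 * eta).
    by rewrite -ss -powR_mulrn ?(le_trans _ s1)// -powRrM.
  by apply: powR_bernoulli; lra.
have -> : ln f = 2 * ln s by rewrite -ss lnXn ?mulr_natl//; lra.
have ls := @le_oneBV_ln s ltac:(lra).
have : - (6 * (s - 1)) <= 3 / eta * (1 - f `^ eta).
  rewrite [leRHS]mulrAC ler_pdivlMr//; nra.
suff : - (2 * (1 - s^-1)) <= - (6 * (s - 1)) + 2 * (s ^+ 2 - 1) by rewrite -ss; lra.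
have sV : s * s^-1 = 1 by rewrite mulfV//; lra.
rewrite -subr_ge0 -(pmulr_rge0 _ (_ : 0 < s)); last by lra.
have -> : s * (- (6 * (s - 1)) + 2 * (s ^+ 2 - 1) - - (2 * (1 - s^-1))) =
  2 * s ^+ 3 - 6 * s ^+ 2 + 6 * s - 2 * (s * s^-1) by ring.
rewrite sV.
have -> : 2 * s ^+ 3 - 6 * s ^+ 2 + 6 * s - 2 * 1 = 2 * (s - 1) ^+ 3 by ring.
by rewrite mulr_ge0// exprn_ge0//; lra.
Qed.

(** Cauchy-Schwarz from the termwise inequality [2 * W <= l * V + U / l], used at [l = W / V]. *)
Lemma sum_sqr_le_sumM_sumV (I : finType) (w v : I -> R) :
  (forall i, 0 < v i) -> (forall i, 0 <= w i) ->
  (\sum_i w i) ^+ 2 <= (\sum_i v i) * (\sum_i w i ^+ 2 / v i).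
Proof.
move=> v0 w0.
set W := \sum_i w i; set V := \sum_i v i; set U := \sum_i _.
have V0 : 0 <= V by apply: sumr_ge0 => i _; exact: ltW.
have U0 : 0 <= U by apply: sumr_ge0 => i _; rewrite divr_ge0 ?sqr_ge0// ltW.
have W0 : 0 <= W by exact: sumr_ge0.
have key l : 0 < l -> 2 * W <= l * V + U / l.
  move=> l0; rewrite /W /V /U !mulr_sumr mulr_suml -big_split/=.
  apply: ler_sum => i _; have vi := v0 i.
  have : 0 <= (l * v i - w i) ^+ 2 / (l * v i).
    by rewrite divr_ge0 ?sqr_ge0// ltW// mulr_gt0.
  suff -> : (l * v i - w i) ^+ 2 / (l * v i) = l * v i + w i ^+ 2 / v i / l - 2 * w i by lra.
  by field; rewrite !gt_eqF.
have [->|Wn] := eqVneq W 0; first by rewrite expr0n/= mulr_ge0.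
have W1 : 0 < W by rewrite lt_def Wn.
have V1 : 0 < V.
  rewrite lt_def V0 andbT; apply: contra_neq Wn => V00.
  apply: big1 => i _; have := v0 i.
  suff -> : v i = 0 by rewrite ltxx.
  by move/psumr_eq0P: V00 => ->// j _; exact: ltW.
have := key (W / V) (divr_gt0 W1 V1).
rewrite divfK ?gt_eqF// => H.
have : W <= U / (W / V) by lra.
by rewrite ler_pdivlMr ?divr_gt0// mulrA ler_pdivrMr// -expr2 mulrC.
Qed.

End real_inequalities.

(** * Independent samples *)

Lemma measurable_set_lt {R : realType} {d} {T : measurableType d} (f g : T -> R) :
  measurable_fun setT f -> measurable_fun setT g -> measurable [set x | f x < g x].
Proof.
move=> mf mg.
have -> : [set x | f x < g x] = ~` [set x | g x <= f x].
  by apply/seteqP; split=> x /=; rewrite ltNge => /negP.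
apply: measurableC; rewrite -[X in measurable X]setTI.
exact: measurable_fun_le.
Qed.

Lemma integral_probability_cst {R : realType} {d} {T : measurableType d}
  (Q : probability T R) (c : R) : (\int[Q]_x c%:E)%E = c%:E.
Proof.
rewrite integral_cst// [X in (_ * X)%E](_ : _ = 1%E) ?mule1//.
exact: (@probability_setT _ _ _ Q).
Qed.

Section boxes.
Context {d} {X : measurableType d} {n : nat}.

Definition box (A : 'I_n -> set X) : set (n.-tuple X) :=
  [set x | forall i, A i (tnth x i)].

Definition boxes : set (set (n.-tuple X)) :=
  [set B | exists2 A : 'I_n -> set X, (forall i, measurable (A i)) & B = box A].

Lemma measurable_box (A : 'I_n -> set X) :
  (forall i, measurable (A i)) -> measurable (box A).
Proof.
move=> mA.
have -> : box A = \bigcap_(i in [set: 'I_n]) ((@tnth n X ^~ i) @^-1` A i).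
  by apply/seteqP; split=> [x Ax i _|x Ax i]; [exact: Ax|exact: (Ax i I)].
apply: fin_bigcap_measurable => [|i _]; first exact: finite_finset.
by rewrite -[_ @^-1` _]setTI; exact: measurable_tnth.
Qed.

Lemma measurable_boxesE : measurable = <<s boxes >>.
Proof.
apply/seteqP; split.
- apply: smallest_sub; first exact: smallest_sigma_algebra.
  move=> B; rewrite -bigcup_seq => -[i /= _ [A mA <-]]; rewrite setTI.
  apply: sub_sigma_algebra; exists (fun j => if j == i then A else setT).
    by move=> j; case: ifP.
  apply/seteqP; split=> [x Ax j|x /(_ i)]; last by rewrite eqxx.
  by case: eqP => // ->.
- apply: smallest_sub; first exact: sigma_algebra_measurable.
  by move=> _ [A mA ->]; exact: measurable_box.
Qed.

Lemma boxes_setI : setI_closed boxes.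
Proof.
move=> _ _ [A mA ->] [B mB ->]; exists (fun i => A i `&` B i).
  by move=> i; exact: measurableI.
by apply/seteqP; split=> [x [Ax Bx] i|x ABx]; [|split=> i; have [] := ABx i].
Qed.
End boxes.

Section prefixes.
Context {d} {X : measurableType d} {n : nat}.

(** Overwriting the later coordinates by [point] keeps prefixes of all lengths in the one type
    [n.-tuple X]; functions of a prefix are those that masking leaves unchanged. *)
Definition prefix_mask (k : nat) (x : n.-tuple X) : n.-tuple X :=
  [tuple if (i < k)%N then tnth x i else point | i < n].

Definition prefix_dependent {T : Type} (k : nat) (F : n.-tuple X -> T) : Prop :=
  forall x y, (forall i : 'I_n, (i < k)%N -> tnth x i = tnth y i) -> F x = F y.

Lemma prefix_dependent_mask {T : Type} k (F : n.-tuple X -> T) x :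
  prefix_dependent k F -> F (prefix_mask k x) = F x.
Proof. by apply=> i ik; rewrite tnth_mktuple ik. Qed.

Lemma measurable_prefix_mask k : measurable_fun setT (prefix_mask k).
Proof.
apply/measurable_fun_tnthP => i.
have [ik|ik] := boolP (i < k)%N.
- rewrite (_ : _ \o _ = @tnth n X ^~ i); first exact: measurable_tnth.
  by apply/funext => x /=; rewrite tnth_mktuple ik.
- rewrite (_ : _ \o _ = cst point); first exact: measurable_cst.
  by apply/funext => x /=; rewrite tnth_mktuple (negbTE ik).
Qed.

End prefixes.

Section independent_coordinates.
Context {R : realType} {d d'} {X : measurableType d} {Omega : measurableType d'}
  (P : probability Omega R) (n : nat) (Xs : 'I_n -> {RV P >-> X})
  (Q : probability X R).
Hypothesis lawQ : forall i A, measurable A -> P (Xs i @^-1` A) = Q A.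
Hypothesis indep : forall A : 'I_n -> set X, (forall i, measurable (A i)) ->
  P (\bigcap_i (Xs i @^-1` A i)) = (\prod_(i < n) P (Xs i @^-1` A i))%E.

Definition sample (w : Omega) : n.-tuple X := [tuple Xs i w | i < n].

Lemma tnth_sample w i : tnth (sample w) i = Xs i w.
Proof. by rewrite tnth_mktuple. Qed.

Lemma measurable_sample : measurable_fun setT sample.
Proof.
apply/measurable_fun_tnthP => i; rewrite (_ : _ \o _ = Xs i).
  exact: measurable_funPT.
by apply/funext => w /=; rewrite tnth_sample.
Qed.

Definition prefix_sample k w := prefix_mask k (sample w).

Lemma measurable_prefix_sample k : measurable_fun setT (prefix_sample k).
Proof. exact: measurableT_comp (measurable_prefix_mask k) measurable_sample. Qed.

HB.instance Definition _ k := @isMeasurableFun.Build _ _ _ _ (prefix_sample k)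
  (measurable_prefix_sample k).

(** A masked coordinate is constantly [point], so its constraint is either void or impossible. *)
Let prefix_box (k : nat) (A : 'I_n -> set X) (i : 'I_n) : set X :=
  if (i < k)%N then A i else if point \in A i then setT else set0.

Lemma prefix_sample_box k A :
  prefix_sample k @^-1` box A = \bigcap_i (Xs i @^-1` prefix_box k A i).
Proof.
apply/seteqP; split=> [w Aw i _|w Aw i].
- have := Aw i; rewrite tnth_mktuple /= /prefix_box tnth_sample; case: ifP => //= _.
  by move=> Ap; rewrite mem_set.
- have := Aw i I; rewrite tnth_mktuple /= /prefix_box tnth_sample; case: ifP => //= _.
  by case: ifP => // /set_mem.
Qed.

Lemma prefix_sample_indep_box (k : 'I_n) A B : (forall i, measurable (A i)) ->
  measurable B ->
  P (prefix_sample k @^-1` box A `&` Xs k @^-1` B) =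
  (P (prefix_sample k @^-1` box A) * Q B)%E.
Proof.
move=> mA mB.
have mp i : measurable (prefix_box k A i).
  by rewrite /prefix_box; case: ifP => // _; case: ifP.
rewrite prefix_sample_box.
pose C i := if i == k then prefix_box k A i `&` B else prefix_box k A i.
have mC i : measurable (C i) by rewrite /C; case: ifP => // _; exact: measurableI.
have -> : \bigcap_i (Xs i @^-1` prefix_box k A i) `&` Xs k @^-1` B =
    \bigcap_i (Xs i @^-1` C i).
  apply/seteqP; split=> [w [Aw Bw] i _|w Cw]; first by
    rewrite /C /=; case: eqP => [->|_]; [split => //; exact: Aw|exact: Aw].
  split; last by have := Cw k I; rewrite /C /= eqxx => -[].
  move=> i _; have := Cw i I; rewrite /C /=; case: eqP => [->|_]//; by case.
rewrite !indep// (bigD1 k)//= [in RHS](bigD1 k)//=.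
rewrite [X in (_ * X = _)%E](eq_bigr (fun i => P (Xs i @^-1` prefix_box k A i))); last first.
  by move=> i ik; rewrite /C (negbTE ik).
(* Coordinate [k] is masked in its own prefix: either it is free to carry [B] alone, or both sides
   vanish. *)
have ek : prefix_box k A k = if point \in A k then setT else set0.
  by rewrite /prefix_box ltnn.
have -> : C k = prefix_box k A k `&` B by rewrite /C eqxx.
rewrite (lawQ _ (mp k)) (lawQ _ (measurableI _ _ (mp k) mB)) ek.
case: ifP => _; first by rewrite setTI probability_setT mul1e muleC.
by rewrite set0I measure0 !mul0e.
Qed.

(** For fixed [B] both sides are finite measures in [A] that agree on boxes, a generating class
    closed under intersection. *)
Lemma prefix_sample_indep (k : 'I_n) (A : set (n.-tuple X)) B : measurable A ->
  measurable B ->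
  P (prefix_sample k @^-1` A `&` Xs k @^-1` B) =
  (P (prefix_sample k @^-1` A) * Q B)%E.
Proof.
move=> mA mB.
have mXB : measurable (Xs k @^-1` B) by rewrite -[X in measurable X]setTI; exact: measurable_funPT.
have mpre := measurable_prefix_sample k.
pose m1 : {measure set (n.-tuple X) -> \bar R} :=
  measure_function_pushforward__canonical__measure_function_Measure
    (mrestr P mXB) mpre.
pose m2 : {measure set (n.-tuple X) -> \bar R} :=
  mscale (NngNum (fine_ge0 (measure_ge0 Q B))) (distribution P (prefix_sample k)).
have m1E C : m1 C = P (prefix_sample k @^-1` C `&` Xs k @^-1` B) by [].
have m2E C : m2 C = (P (prefix_sample k @^-1` C) * Q B)%E.
  by rewrite /m2 /= /mscale/= fineK ?fin_num_measure// muleC.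
rewrite -m1E -m2E.
apply: (measure_unique boxes (fun=> setT) measurable_boxesE boxes_setI) => //.
- move=> _; exists (fun=> setT) => //.
  by apply/seteqP; split.
- by rewrite bigcup_const//; exists 0%N.
- by move=> _ [C mC ->]; rewrite m1E m2E prefix_sample_indep_box.
- by move=> _; rewrite m1E preimage_setT setTI lawQ// -ge0_fin_numE ?fin_num_measure.
Qed.

Lemma prefix_sample_product (k : 'I_n) (C : set (n.-tuple X * X)) : measurable C ->
  P ((fun w => (prefix_sample k w, Xs k w)) @^-1` C) =
  (distribution P (prefix_sample k) \x Q)%E C.
Proof.
move=> mC.
have mpair : measurable_fun setT (fun w => (prefix_sample k w, Xs k w)).
  by apply: measurable_fun_pair => //; exact: measurable_prefix_sample.
pose m' : {measure set (n.-tuple X * X) -> \bar R} :=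
  measure_function_pushforward__canonical__measure_function_Measure P mpair.
rewrite (@product_measure_unique _ _ _ _ _ _ _ m')// => A B mA mB.
exact: prefix_sample_indep.
Qed.

Lemma integral_prefix_sample (k : 'I_n) (F : n.-tuple X * X -> \bar R) :
  measurable_fun [set: n.-tuple X * X] F -> (forall z, 0 <= F z)%E ->
  (\int[P]_w F (prefix_sample k w, Xs k w) =
   \int[P]_w \int[Q]_y F (prefix_sample k w, y))%E.
Proof.
move=> mF F0.
have mpair : measurable_fun setT (fun w => (prefix_sample k w, Xs k w)).
  by apply: measurable_fun_pair => //; exact: measurable_prefix_sample.
pose m' : {measure set (n.-tuple X * X) -> \bar R} :=
  measure_function_pushforward__canonical__measure_function_Measure P mpair.
transitivity (\int[m']_z F z)%E.
  by rewrite ge0_integral_pushforward.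
transitivity (\int[(distribution P (prefix_sample k) \x Q)%E]_z F z)%E.
  apply: eq_measure_integral => C mC _; exact: prefix_sample_product.
rewrite fubini_tonelli1// ge0_integral_distribution//.
  exact: measurable_fun_fubini_tonelli_F.
by move=> y; apply: integral_ge0.
Qed.


(** Observation [k] is independent of its prefix and has law [Q], so it can be integrated out first,
    at a factor of at most 1. This is the supermartingale property without conditional
    expectations. *)
Lemma integral_chain_step (k : 'I_n) (H : n.-tuple X -> R)
    (G : n.-tuple X -> X -> R) :
  measurable_fun setT H -> (forall x, 0 <= H x) -> prefix_dependent k H ->
  measurable_fun setT (fun z : n.-tuple X * X => G z.1 z.2) ->
  (forall x y, 0 <= G x y) -> (forall y, prefix_dependent k (G ^~ y)) ->
  (forall x, \int[Q]_y (G x y)%:E <= 1)%E ->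
  (\int[P]_w (H (sample w) * G (sample w) (Xs k w))%:E <=
   \int[P]_w (H (sample w))%:E)%E.
Proof.
move=> mH H0 Hk mG G0 Gk G1.
pose F (z : n.-tuple X * X) : \bar R := (H z.1 * G z.1 z.2)%:E.
have mF : measurable_fun setT F.
  apply/measurable_EFinP; apply: measurable_funM => //.
  exact: measurableT_comp mH measurable_fst.
have F0 z : (0 <= F z)%E by rewrite lee_fin mulr_ge0.
have -> : (\int[P]_w (H (sample w) * G (sample w) (Xs k w))%:E =
           \int[P]_w F (prefix_sample k w, Xs k w))%E.
  apply: eq_integral => w _; rewrite /F /= /prefix_sample.
  by rewrite (prefix_dependent_mask _ Hk) (prefix_dependent_mask _ (Gk _)).
rewrite integral_prefix_sample//.
have mHs : measurable_fun setT (fun w => (H (sample w))%:E).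
  by apply/measurable_EFinP; exact: measurableT_comp mH measurable_sample.
have mI : measurable_fun setT (fun x : n.-tuple X => \int[Q]_y F (x, y))%E.
  exact: measurable_fun_fubini_tonelli_F.
apply: ge0_le_integral => //=.
- by move=> w _; exact: integral_ge0.
- exact: measurableT_comp mI (measurable_prefix_sample k).
move=> w _; rewrite /F/=.
under eq_integral do rewrite EFinM.
have mGw : measurable_fun setT (fun y => (G (prefix_sample k w) y)%:E).
  apply/measurable_EFinP; have mh : measurable_fun setT
    (fun y : X => (prefix_sample k w, y)) by exact: measurable_fun_pair.
  exact: measurableT_comp mG mh.
rewrite ge0_integralZl//; last 2 first.
- by move=> y _; rewrite lee_fin.
- by rewrite lee_fin.
rewrite /prefix_sample (prefix_dependent_mask _ Hk).
rewrite -[leRHS]mule1; apply: lee_pmul => //; first by rewrite lee_fin.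
  by apply: integral_ge0 => y _; rewrite lee_fin.
Qed.

(** The factor [H] lets the bound carry an event of the first [m] observations, such as the value of
    a data-dependent choice of the [G i]. *)
Lemma integral_chain (m : nat) (H : n.-tuple X -> R)
    (G : 'I_n -> n.-tuple X -> X -> R) :
  measurable_fun setT H -> (forall x, 0 <= H x) -> prefix_dependent m H ->
  (forall i, measurable_fun setT (fun z : n.-tuple X * X => G i z.1 z.2)) ->
  (forall i x y, 0 <= G i x y) ->
  (forall (i : 'I_n) y, prefix_dependent i (G i ^~ y)) ->
  (forall i x, \int[Q]_y (G i x y)%:E <= 1)%E ->
  (\int[P]_w (H (sample w) * \prod_(i < n | (m <= i)%N) G i (sample w) (Xs i w))%:E <=
   \int[P]_w (H (sample w))%:E)%E.
Proof.
move=> mH H0 Hm mG G0 Gk G1.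
pose K j x := H x * \prod_(i < n | (m <= i < j)%N) G i x (tnth x i).
have mK j : measurable_fun setT (K j).
  apply: measurable_funM => //.
  under eq_fun do rewrite -big_filter; apply: measurable_prod => i _.
  have mh : measurable_fun setT (fun x : n.-tuple X => (x, tnth x i)).
    by apply: measurable_fun_pair => //; exact: measurable_tnth.
  exact: measurableT_comp (mG i) mh.
have K0 j x : 0 <= K j x by rewrite mulr_ge0// prodr_ge0.
have KE w : K n (sample w) =
    H (sample w) * \prod_(i < n | (m <= i)%N) G i (sample w) (Xs i w).
  congr (_ * _); apply: eq_big => [i|i _]; first by rewrite ltn_ord andbT.
  by rewrite tnth_sample.
under eq_integral do rewrite -KE.
have : (n <= n)%N by [].
elim: {-2}n => [|j IH] jn.
  rewrite le_eqVlt; apply/orP; left; apply/eqP; apply: eq_integral => w _.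
  by rewrite /K big_pred0 ?mulr1// => i; rewrite ltn0 andbF.
apply: le_trans (IH (ltnW jn)).
pose k := Ordinal jn.
have [mj|mj] := leqP m j; last first.
  rewrite le_eqVlt; apply/orP; left; apply/eqP; apply: eq_integral => w _.
  rewrite /K !big_pred0// => i; apply/negP => /andP[mi ij].
    by have := leq_trans mj (leq_trans mi (ltnW ij)); rewrite ltnn.
  by have := leq_trans mj (leq_trans mi ij); rewrite ltnn.
have KS x : K j.+1 x = K j x * G k x (tnth x k).
  rewrite /K (bigD1 k)/=; last by rewrite mj ltnSn.
  rewrite -mulrA [G k _ _ * _]mulrC; congr (_ * (_ * _)).
  apply: eq_bigl => i; rewrite ltnS (leq_eqVlt i j) -val_eqE /=.
  by case: (ltngtP i j); rewrite ?andbT ?andbF.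
under eq_integral do rewrite KS tnth_sample.
apply: (@integral_chain_step k (K j) (G k)) => //.
  move=> x y xy; rewrite /K (Hm x y) => [|i im]; last by apply: xy; exact: leq_trans im mj.
  congr (_ * _); apply: eq_bigr => i /andP[mi ij].
  rewrite (xy i ij) (Gk i _ x y)// => l li; apply: xy.
  exact: ltn_trans li ij.
Qed.

Lemma markov_ge (Y : Omega -> R) (a c : R) : 0 < a ->
  measurable_fun setT Y -> (forall w, 0 <= Y w) ->
  (\int[P]_w (Y w)%:E <= c%:E)%E ->
  (P [set w | (a < Y w)%R] <= (c / a)%:E)%E.
Proof.
move=> a0 mY Y0 Yc.
have mA : measurable [set w | a < Y w].
  by apply: measurable_set_lt => //; exact: measurable_cst.
have : (a%:E * P [set w | (a < Y w)%R] <= c%:E)%E.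
  apply: le_trans Yc.
  have := @le_integral_comp_abse _ _ _ P _ measurableT (EFin \o Y) a id.
  move=> /(_ (@measurable_id _ _ _)) /= H.
  have := H (fun _ => id) (fun x y _ _ => id) _ a0.
  under [X in (_ <= X)%E]eq_integral do rewrite ger0_norm//.
  move=> /(_ ltac:(exact/measurable_EFinP)); apply: le_trans.
  rewrite lee_pmul2l// ?lte_fin// setTI; apply: le_measure; rewrite ?inE//.
    rewrite -[X in measurable X]setTI; apply: measurable_fun_le => //.
    exact: measurableT_comp.
  by move=> w /= aY; rewrite lee_fin ger0_norm// ltW.
rewrite muleC -lee_pdivlMr// => /le_trans; apply.
Qed.

End independent_coordinates.

(** * The unnormalised Hellinger functional *)

Section measurability.
Context {R : realType} {d} {T : measurableType d}.
Implicit Types f : T -> R.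

Lemma measurable_fun_sqrt f : measurable_fun setT f ->
  measurable_fun setT (fun x => Num.sqrt (f x)).
Proof.
move=> mf; apply: measurableT_comp mf.
by apply: continuous_measurable_fun; exact: sqrt_continuous.
Qed.

(** On nonnegative reals the inverse is the power of exponent -1 even at 0, where both are 0. *)
Lemma measurable_fun_inv_ge0 f : measurable_fun setT f -> (forall x, 0 <= f x) ->
  measurable_fun setT (fun x => (f x)^-1).
Proof.
move=> mf f0; under eq_fun do rewrite -powR_inv1//.
by apply: (measurableT_comp (measurable_powR (-1))).
Qed.

End measurability.

Section real_integrable.
Context {R : realType} {d} {T : measurableType d} (Q : probability T R).
Implicit Types g h : T -> R.

Lemma integrable_scale (c : R) g : Q.-integrable setT (EFin \o g) ->
  Q.-integrable setT (EFin \o (fun x => c * g x)).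
Proof. by move=> ig; have := integrableZl measurableT c ig. Qed.

Lemma integrable_add g h : Q.-integrable setT (EFin \o g) ->
  Q.-integrable setT (EFin \o h) ->
  Q.-integrable setT (EFin \o (fun x => g x + h x)).
Proof. by move=> ig ih; have := integrableD measurableT ig ih. Qed.

Lemma integrable_opp g : Q.-integrable setT (EFin \o g) ->
  Q.-integrable setT (EFin \o (fun x => - g x)).
Proof. by move=> ig; have := integrableN ig. Qed.

End real_integrable.

Section mixture.
Context {R : realType} {T : Type} {M : nat}.
Implicit Types (u v : 'I_M -> R) (f : 'I_M -> T -> R).

Definition mass u : R := \sum_j u j.

Definition mixture f u (x : T) : R := \sum_j u j * f j x.

Lemma mass_lin a b u v :
  mass (fun j => a * u j + b * v j) = a * mass u + b * mass v.
Proof. by rewrite /mass big_split/= -!mulr_sumr. Qed.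

Lemma mixture_lin f a b u v x :
  mixture f (fun j => a * u j + b * v j) x = a * mixture f u x + b * mixture f v x.
Proof.
rewrite /mixture !mulr_sumr -big_split/=; apply: eq_bigr => j _.
by rewrite mulrDl !mulrA.
Qed.

Lemma mixture_ge0 f u x : (forall j x, 0 <= f j x) -> (forall j, 0 <= u j) ->
  0 <= mixture f u x.
Proof. by move=> f0 u0; apply: sumr_ge0 => j _; rewrite mulr_ge0. Qed.

Lemma le_mixture f u v x : (forall j x, 0 <= f j x) -> (forall j, u j <= v j) ->
  mixture f u x <= mixture f v x.
Proof. by move=> f0 uv; apply: ler_sum => j _; rewrite ler_wpM2r. Qed.

End mixture.

Section hellinger.
Context {R : realType} {d} {X : measurableType d} {M : nat}
  (Q : probability X R) (f : 'I_M -> X -> R).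
Hypothesis mf : forall j, measurable_fun setT (f j).
Hypothesis f0 : forall j x, 0 <= f j x.
Hypothesis f1 : forall j, (\int[Q]_x (f j x)%:E <= 1)%E.
Implicit Types u v : 'I_M -> R.

(** [mass u] stands where the integral of [mixture f u] would be expected: components may put mass
    where the truth puts none. [Q] does not see that mass, but the Hellinger distance must count
    it. *)
Definition hellinger u : R :=
  1 + mass u - 2 * \int[Q]_x Num.sqrt (mixture f u x).

Lemma measurable_mixture u : measurable_fun setT (mixture f u).
Proof. by apply: measurable_sum => j; exact: measurable_funM. Qed.

Let ge0_integrable (g : X -> R) : measurable_fun setT g -> (forall x, 0 <= g x) ->
  (\int[Q]_x (g x)%:E < +oo)%E -> Q.-integrable setT (EFin \o g).
Proof.
move=> mg g0 goo; apply/integrableP; split; first exact/measurable_EFinP.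
by under eq_integral do rewrite /= ger0_norm//.
Qed.

Lemma integral_mixture_le u : (forall j, 0 <= u j) ->
  (\int[Q]_x (mixture f u x)%:E <= (mass u)%:E)%E.
Proof.
move=> u0; rewrite /mixture.
under eq_integral do rewrite -sumEFin.
rewrite ge0_integral_sum//; last 2 first.
- by move=> j; apply/measurable_EFinP; exact: measurable_funM.
- by move=> j x _; rewrite lee_fin mulr_ge0.
rewrite /mass -sumEFin; apply: lee_sum => j _.
under eq_integral do rewrite EFinM.
rewrite ge0_integralZl//; last 3 first.
- exact/measurable_EFinP.
- by move=> x _; rewrite lee_fin.
- by rewrite lee_fin.
by rewrite -[leRHS]mule1 lee_wpmul2l// lee_fin.
Qed.

Lemma integrable_mixture u : (forall j, 0 <= u j) ->
  Q.-integrable setT (EFin \o mixture f u).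
Proof.
move=> u0; apply: ge0_integrable; first exact: measurable_mixture.
  by move=> x; exact: mixture_ge0.
by apply: le_lt_trans (integral_mixture_le u0) _; rewrite ltry.
Qed.

Let integrable_cst (c : R) : Q.-integrable setT (EFin \o cst c).
Proof. exact: finite_measure_integrable_cst. Qed.

Lemma integrable_sqrt_mixture u : (forall j, 0 <= u j) ->
  Q.-integrable setT (EFin \o (fun x => Num.sqrt (mixture f u x))).
Proof.
move=> u0; apply: (le_integrable measurableT _ _
  (integrableD measurableT (integrable_cst 1) (integrable_mixture u0))).
  by apply/measurable_EFinP/measurable_fun_sqrt; exact: measurable_mixture.
move=> x _ /=; rewrite lee_fin ger0_norm ?sqrtr_ge0//.
have F0 := mixture_ge0 x f0 u0.
rewrite ger0_norm ?addr_ge0//.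
have := sqr_sqrtr F0; have := sqr_ge0 (Num.sqrt (mixture f u x) - 1).
move: (Num.sqrt _) => s; nra.
Qed.

Let Rintegral_EFin (g : X -> R) : Q.-integrable setT (EFin \o g) ->
  (\int[Q]_x (g x)%:E)%E = (\int[Q]_x g x)%:E.
Proof. by move=> ig; rewrite fineK//; exact: integrable_fin_num. Qed.

Lemma Rintegral_mixture_le u : (forall j, 0 <= u j) ->
  \int[Q]_x mixture f u x <= mass u.
Proof.
move=> u0; rewrite -lee_fin -Rintegral_EFin; last exact: integrable_mixture.
exact: integral_mixture_le.
Qed.

(** The pointwise inequalities integrated below are affine in at most five functions, the number
    needed at a midpoint; spare slots get coefficient 0. *)
Let affine_ge0 c a1 a2 a3 a4 a5 (g1 g2 g3 g4 g5 : X -> R) :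
  Q.-integrable setT (EFin \o g1) -> Q.-integrable setT (EFin \o g2) ->
  Q.-integrable setT (EFin \o g3) -> Q.-integrable setT (EFin \o g4) ->
  Q.-integrable setT (EFin \o g5) ->
  (forall x, 0 <= c + (a1 * g1 x + (a2 * g2 x + (a3 * g3 x + (a4 * g4 x + a5 * g5 x))))) ->
  0 <= c + (a1 * \int[Q]_x g1 x + (a2 * \int[Q]_x g2 x + (a3 * \int[Q]_x g3 x +
       (a4 * \int[Q]_x g4 x + a5 * \int[Q]_x g5 x)))).
Proof.
move=> i1 i2 i3 i4 i5 ge0.
have ic : \int[Q]_x (cst c x) = c.
  rewrite Rintegral_cst// [X in fine X](_ : _ = 1%E) ?mulr1//; exact: (@probability_setT _ _ _ Q).
have -> : c + (a1 * \int[Q]_x g1 x + (a2 * \int[Q]_x g2 x + (a3 * \int[Q]_x g3 x +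
       (a4 * \int[Q]_x g4 x + a5 * \int[Q]_x g5 x)))) =
  \int[Q]_x (cst c x + (a1 * g1 x + (a2 * g2 x + (a3 * g3 x + (a4 * g4 x + a5 * g5 x))))).
  rewrite RintegralD//; last by repeat apply: integrable_add; exact: integrable_scale.
  do 3! (rewrite RintegralD//;
    [|exact: integrable_scale|by repeat apply: integrable_add; exact: integrable_scale]).
  rewrite RintegralD//; [|exact: integrable_scale|exact: integrable_scale].
  by rewrite ic !RintegralZl.
by apply: Rintegral_ge0 => x _; exact: ge0.
Qed.

(* A bound that is affine in [F - 1] and in [1 + F - 2 sqrt F] integrates to the
   same bound in [mass u - 1] and [hellinger u]. *)
Lemma integral_le_hellinger u a b (g : X -> R) : (forall j, 0 <= u j) ->
  measurable_fun setT g -> (forall x, 0 <= g x) -> 0 <= a + b ->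
  (forall x, g x <= 1 + a * (mixture f u x - 1) +
    b * (1 + mixture f u x - 2 * Num.sqrt (mixture f u x))) ->
  (\int[Q]_x (g x)%:E <= (1 + a * (mass u - 1) + b * hellinger u)%:E)%E.
Proof.
move=> u0 mg g0 ab gle.
have iF := integrable_mixture u0; have iS := integrable_sqrt_mixture u0.
have ig : Q.-integrable setT (EFin \o g).
  pose B x := (1 - a + b) + ((a + b) * mixture f u x +
                        - (2 * b) * Num.sqrt (mixture f u x)).
  have iB : Q.-integrable setT (EFin \o B).
    exact: integrable_add (integrable_cst _) (integrable_add
      (integrable_scale (a + b) iF) (integrable_scale (- (2 * b)) iS)).
  apply: (le_integrable measurableT _ _ iB); first exact/measurable_EFinP.
  move=> x _ /=; rewrite lee_fin ger0_norm//.
  have gB : g x <= B x by apply: (le_trans (gle x)); rewrite /B; lra.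
  by rewrite ger0_norm// (le_trans _ gB).
rewrite Rintegral_EFin// lee_fin.
have := @affine_ge0 (1 - a + b) (-1) (a + b) (- (2 * b)) 0 0 g _ _ g g
  ig iF iS ig ig.
have mu_ := Rintegral_mixture_le u0.
move=> /(_ ltac:(move=> x; have := gle x; lra)).
rewrite /hellinger; move: mu_; move: (\int[Q]_x mixture f u x) => EF mu_.
(* The integral of the mixture is only bounded above by its mass, so its total coefficient has to be
   nonnegative. *)
have : (a + b) * EF <= (a + b) * mass u by rewrite ler_wpM2l.
lra.
Qed.

Lemma integral_sqrt_mixture u : (forall j, 0 <= u j) ->
  (\int[Q]_x (Num.sqrt (mixture f u x))%:E)%E =
  (1 + (mass u - 1) / 2 - hellinger u / 2)%:E.
Proof.
move=> u0; rewrite Rintegral_EFin; last exact: integrable_sqrt_mixture.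
by congr EFin; rewrite /hellinger; lra.
Qed.

Lemma hellinger_midpoint u v : (forall j, 0 <= u j) -> (forall j, 0 <= v j) ->
  hellinger u / 25 - hellinger v <= hellinger (fun j => 2^-1 * u j + 2^-1 * v j).
Proof.
move=> u0 v0; set w := fun j => _.
have w0 j : 0 <= w j by rewrite addr_ge0// mulr_ge0.
have := @affine_ge0 (1 - 25^-1 + 1) (-2) (2^-1 - 25^-1) (2 / 25) (2^-1 + 1) (-2)
  _ _ _ _ _ (integrable_sqrt_mixture w0) (integrable_mixture u0)
  (integrable_sqrt_mixture u0) (integrable_mixture v0) (integrable_sqrt_mixture v0).
have -> : hellinger w = 1 + (2^-1 * mass u + 2^-1 * mass v)
    - 2 * \int[Q]_x Num.sqrt (mixture f w x) by rewrite /hellinger -mass_lin.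
have mu_ := Rintegral_mixture_le u0; have mv := Rintegral_mixture_le v0.
move=> H; have {H} := H ltac:(
  move=> x; rewrite /w mixture_lin;
  have := sqrt_midpoint (mixture_ge0 x f0 u0) (mixture_ge0 x f0 v0);
  rewrite (_ : (mixture f u x + mixture f v x) / 2 =
    2^-1 * mixture f u x + 2^-1 * mixture f v x); [lra|lra]).
rewrite /hellinger; move: mu_ mv.
move: (\int[Q]_x mixture f u x) (\int[Q]_x mixture f v x) => EF EG mu_ mv.
lra.
Qed.

Lemma hellinger_conv l u v : 0 <= l <= 1 -> (forall j, 0 <= u j) ->
  (forall j, 0 <= v j) ->
  hellinger (fun j => l * u j + (1 - l) * v j) <=
  l * hellinger u + (1 - l) * hellinger v.
Proof.
move=> /andP[l0 l1] u0 v0; set w := fun j => _.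
have w0 j : 0 <= w j by rewrite addr_ge0// mulr_ge0// subr_ge0.
have := @affine_ge0 0 1 (- l) (- (1 - l)) 0 0
  _ _ _ _ _ (integrable_sqrt_mixture w0) (integrable_sqrt_mixture u0)
  (integrable_sqrt_mixture v0) (integrable_mixture v0) (integrable_mixture v0).
have -> : hellinger w = 1 + (l * mass u + (1 - l) * mass v)
    - 2 * \int[Q]_x Num.sqrt (mixture f w x) by rewrite /hellinger -mass_lin.
move=> H; have {H} := H ltac:(
  move=> x; rewrite /w mixture_lin;
  have := sqrt_concave l0 l1 (mixture_ge0 x f0 u0) (mixture_ge0 x f0 v0); lra).
rewrite /hellinger; lra.
Qed.

Lemma hellinger_mono u v : (forall j, 0 <= u j) -> (forall j, u j <= v j) ->
  hellinger v <= hellinger u + (mass v - mass u).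
Proof.
move=> u0 uv.
have v0 j : 0 <= v j by exact: le_trans (uv j).
have : \int[Q]_x Num.sqrt (mixture f u x) <= \int[Q]_x Num.sqrt (mixture f v x).
  apply: le_Rintegral => //; [exact: integrable_sqrt_mixture..|].
  by move=> x _; rewrite ler_wsqrtr// le_mixture.
rewrite /hellinger; lra.
Qed.

Lemma hellinger_ge0 u : (forall j, 0 <= u j) -> 0 <= hellinger u.
Proof.
move=> u0.
have := @affine_ge0 1 1 (-2) 0 0 0 _ _ _ _ _ (integrable_mixture u0)
  (integrable_sqrt_mixture u0) (integrable_mixture u0) (integrable_mixture u0)
  (integrable_mixture u0).
move=> H; have {H} := H ltac:(
  move=> x; have := sqr_sqrtr (mixture_ge0 x f0 u0);
  have := sqr_ge0 (Num.sqrt (mixture f u x) - 1);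
  move: (Num.sqrt _) => s; nra).
have := Rintegral_mixture_le u0; rewrite /hellinger; lra.
Qed.

Lemma hellinger_contract u v : (forall j, 0 <= u j) -> (forall j, 0 <= v j) ->
  (forall x, 2 / 3 + mixture f u x / 3 <= mixture f v x) ->
  hellinger v <= hellinger u / 3 + (mass v - (2 + mass u) / 3).
Proof.
move=> u0 v0 uv.
have := @affine_ge0 (- (2 / 3)) 1 (- 3^-1) 0 0 0 _ _ _ _ _ (integrable_sqrt_mixture v0)
  (integrable_sqrt_mixture u0) (integrable_mixture u0) (integrable_mixture u0)
  (integrable_mixture u0).
move=> H; have {H} := H ltac:(
  move=> x; have := sqrt_contract (mixture_ge0 x f0 u0) (uv x); lra).
rewrite /hellinger; lra.
Qed.

Lemma integral_inv_sqrt4_le u v : (forall j, 0 <= u j) -> (forall j, 0 <= v j) ->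
  (forall x, 2 / 3 + mixture f u x / 3 <= mixture f v x) ->
  (\int[Q]_x (Num.sqrt (Num.sqrt (mixture f v x)))^-1%:E <=
   (1 - (mass u - 1) / 12 + hellinger u / 8)%:E)%E.
Proof.
move=> u0 v0 uv.
have := @integral_le_hellinger u (- 12^-1) (8^-1)
  (fun x => (Num.sqrt (Num.sqrt (mixture f v x)))^-1) u0.
rewrite (_ : 1 + - 12^-1 * _ + _ = 1 - (mass u - 1) / 12 + hellinger u / 8); last by lra.
apply; last 2 first.
- by lra.
- by move=> x; have := inv_sqrt4_contract (mixture_ge0 x f0 u0) (uv x); lra.
- apply: measurable_fun_inv_ge0; last by move=> x; exact: sqrtr_ge0.
  by do 2! apply: measurable_fun_sqrt; exact: measurable_mixture.
- by move=> x; rewrite invr_ge0 sqrtr_ge0.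
Qed.

Lemma integral_inv_sqrt_le u : (forall j, 0 <= u j) ->
  (forall x, 1 / 4 <= mixture f u x) ->
  (\int[Q]_x (Num.sqrt (mixture f u x))^-1%:E <=
   (1 - (mass u - 1) / 2 + 5 / 2 * hellinger u)%:E)%E.
Proof.
move=> u0 u4.
have := @integral_le_hellinger u (- 2^-1) (5 / 2)
  (fun x => (Num.sqrt (mixture f u x))^-1) u0.
rewrite (_ : 1 + - 2^-1 * _ + _ = 1 - (mass u - 1) / 2 + 5 / 2 * hellinger u); last by lra.
apply; last 2 first.
- by lra.
- by move=> x; have := inv_sqrt_quarter (u4 x); lra.
- apply: measurable_fun_inv_ge0; last by move=> x; exact: sqrtr_ge0.
  by apply: measurable_fun_sqrt; exact: measurable_mixture.
- by move=> x; rewrite invr_ge0 sqrtr_ge0.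
Qed.

End hellinger.

(** * Uniform likelihood bounds on lattices *)

Lemma ler_sum_inj {R : realType} {I J : finType} (h : I -> J) (G : J -> R) :
  injective h -> (forall y, 0 <= G y) -> \sum_i G (h i) <= \sum_y G y.
Proof.
move=> hI G0.
have <- : \sum_(y in [set h i | i in I]%SET) G y = \sum_i G (h i).
  by rewrite big_imset//= => ? ? _ _; exact: hI.
by rewrite [leRHS](bigID (mem [set h i | i in I]%SET))/= lerDl sumr_ge0.
Qed.

Section lattice.
Context {R : realType} {M : nat}.
Implicit Types u v : 'I_M -> R.

Definition lattice (N : nat) : Type := {ffun 'I_M -> 'I_N.+1}.
HB.instance Definition _ N := Finite.on (lattice N).

Definition lattice_point N (k : lattice N) : 'I_M -> R :=
  fun j => (k j : nat)%:R / N%:R.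

Lemma lattice_point_ge0 N (k : lattice N) j : 0 <= lattice_point k j.
Proof. by rewrite divr_ge0. Qed.

Lemma lattice_point_le1 N (k : lattice N) j : lattice_point k j <= 1.
Proof.
rewrite /lattice_point; case: N k => [|N] k; first by rewrite invr0 mulr0.
by rewrite ler_pdivrMr ?ltr0n// mul1r ler_nat -ltnS.
Qed.

(** Rounding up sends at most [J ^ M] fine points to each coarse one, so the price of refining does
    not depend on [N]. *)
Lemma sum_lattice_refine J N (phi : ('I_M -> R) -> R) C :
  (0 < N)%N -> (0 < J)%N -> (forall u, 0 <= phi u) ->
  (forall u v, (forall j, 0 <= u j) -> (forall j, u j <= v j) ->
     (forall j, v j <= u j + N%:R^-1) -> phi u <= C * phi v) ->
  \sum_(k : lattice (J * N)) phi (lattice_point k) <=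
  C * J%:R ^+ M * \sum_(k : lattice N) phi (lattice_point k).
Proof.
case: J => [//|J] N0 _ phi0 phiC.
have NR : 0 < N%:R :> R by rewrite ltr0n.
(* The refinement factor is now [J.+1], and [(k j + J) %/ J.+1] is the ceiling of [k j / J.+1]; the
   remainder [r] separates the points of one cell. *)
pose q (k : lattice (J.+1 * N)) : lattice N :=
  [ffun j => inord ((k j + J) %/ J.+1)].
pose r (k : lattice (J.+1 * N)) : {ffun 'I_M -> 'I_J.+1} :=
  [ffun j => inord ((k j + J) %% J.+1)].
have qN (k : lattice (J.+1 * N)) j : ((k j + J) %/ J.+1 < N.+1)%N.
  by rewrite ltn_divLR//; have := ltn_ord (k j); nia.
have qE (k : lattice (J.+1 * N)) j : q k j = ((k j + J) %/ J.+1)%N :> nat.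
  by rewrite ffunE inordK.
have rE (k : lattice (J.+1 * N)) j : r k j = ((k j + J) %% J.+1)%N :> nat.
  by rewrite ffunE inordK// ltn_mod.
have qrI : injective (fun k => (q k, r k)).
  move=> k l [/ffunP qkl /ffunP rkl]; apply/ffunP => j; apply/val_inj => /=.
  have e1 : q k j = q l j :> nat by rewrite qkl.
  have e2 : r k j = r l j :> nat by rewrite rkl.
  rewrite !qE in e1; rewrite !rE in e2.
  apply/eqP; rewrite -(eqn_add2r J).
  by rewrite (divn_eq (k j + J) J.+1) (divn_eq (l j + J) J.+1) e1 e2.
pose G (y : lattice N * {ffun 'I_M -> 'I_J.+1}) := C * phi (lattice_point y.1).
have step k : phi (lattice_point k) <= G (q k, r k).
  rewrite /G /=; apply: phiC => j; first exact: lattice_point_ge0.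
  - rewrite /lattice_point qE ler_pdivrMr ?ltr0n ?muln_gt0//.
    rewrite mulrAC ler_pdivlMr// -!natrM ler_nat.
    have := divn_eq (k j + J) J.+1; have := ltn_pmod (k j + J) (ltn0Sn J).
    nia.
  - rewrite /lattice_point qE natrM invfM mulrA -[_^-1 as X in _ + X]mul1r.
    rewrite -mulrDl ler_wpM2r// ?invr_ge0//.
    rewrite -(@ler_pM2r _ J.+1%:R)// mulrDl mulfVK ?mul1r//.
    rewrite -natrD -natrM ler_nat.
    have := divn_eq (k j + J) J.+1; nia.
have C0 : forall y, 0 <= G y.
  move=> y; apply: le_trans (phiC _ _ _ _ _).
  - exact: (phi0 (lattice_point y.1)).
  - exact: lattice_point_ge0.
  - by [].
  - by move=> j; rewrite lerDl invr_ge0 ltW.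
apply: (le_trans (ler_sum _ (fun k _ => step k))).
apply: (le_trans (ler_sum_inj qrI C0)).
rewrite (eq_bigr (fun y => G (y.1, y.2))); last by move=> [].
rewrite -(pair_bigA _ (fun a b => G (a, b)))/= /G/=.
rewrite (eq_bigr (fun i => C * J.+1%:R ^+ M * phi (lattice_point i))).
  by rewrite mulr_sumr.
move=> i _; rewrite sumr_const card_ffun !card_ord.
by rewrite -[LHS]mulr_natl natrX mulrCA mulrA.
Qed.

Lemma lattice_round_up N u : (0 < N)%N -> (forall j, 0 <= u j <= 1) ->
  exists k : lattice N, forall j, u j <= lattice_point k j <= u j + N%:R^-1.
Proof.
move=> N0 u01; have NR : 0 < N%:R :> R by rewrite ltr0n.
(* The minimum with [N] takes effect only at [u j = 1]. *)
exists [ffun j => inord (minn (Num.truncn (u j * N%:R)).+1 N)] => j.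
rewrite /lattice_point ffunE inordK; last by rewrite ltnS geq_minr.
have /andP[u0 u1] := u01 j.
have uN : 0 <= u j * N%:R by rewrite mulr_ge0.
have /andP[t1 t2] := truncn_itv uN.
apply/andP; split.
- rewrite ler_pdivlMr//; case: leqP => _; first exact: ltW.
  by rewrite ler_piMl// ltW.
- rewrite -[X in _ + X]mul1r ler_pdivrMr// mulrDl mulfVK ?gt_eqF//.
  apply: (@le_trans _ _ (Num.truncn (u j * N%:R)).+1%:R).
    by rewrite ler_nat geq_minl.
  by rewrite -natr1 lerD2r.
Qed.

End lattice.

Lemma integral_sum_le {R : realType} {d} {T : measurableType d} (P : probability T R)
    {I : finType} (c : I -> R) (Y : I -> T -> R) (b B : I -> R) :
  (forall i, 0 <= c i) -> (forall i, measurable_fun setT (Y i)) ->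
  (forall i w, 0 <= Y i w) -> (forall i, \int[P]_w (Y i w)%:E <= (b i)%:E)%E ->
  (forall i, c i * b i <= B i) ->
  (\int[P]_w (\sum_i c i * Y i w)%:E <= (\sum_i B i)%:E)%E.
Proof.
move=> c0 mY Y0 Yb cb.
under eq_integral do rewrite -sumEFin.
rewrite ge0_integral_sum//; last 2 first.
- by move=> i; apply/measurable_EFinP; exact: measurable_funM.
- by move=> i w _; rewrite lee_fin mulr_ge0.
rewrite -sumEFin; apply: lee_sum => i _.
under eq_integral do rewrite EFinM.
rewrite ge0_integralZl//; last 3 first.
- exact/measurable_EFinP.
- by move=> w _; rewrite lee_fin.
- by rewrite lee_fin.
apply: (@le_trans _ _ ((c i)%:E * (b i)%:E)%E).
  by rewrite lee_wpmul2l// lee_fin.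
by rewrite -EFinM lee_fin.
Qed.

(** * Square-root and fourth-root likelihoods on refined lattices *)

Section likelihood_ratios.
Context {R : realType} {d d'} {X : measurableType d} {Omega : measurableType d'}
  (P : probability Omega R) (n : nat) (Xs : 'I_n -> {RV P >-> X})
  (Q : probability X R).
Hypothesis lawQ : forall i A, measurable A -> P (Xs i @^-1` A) = Q A.
Hypothesis indep : forall A : 'I_n -> set X, (forall i, measurable (A i)) ->
  P (\bigcap_i (Xs i @^-1` A i)) = (\prod_(i < n) P (Xs i @^-1` A i))%E.

Lemma measurable_prod_sample (p : pred 'I_n) (g : X -> R) :
  measurable_fun setT g -> measurable_fun setT (fun w => \prod_(i < n | p i) g (Xs i w)).
Proof.
move=> mg; under eq_fun do rewrite -big_filter; apply: measurable_prod => i _.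
by apply: measurableT_comp mg _; exact: measurable_funPT.
Qed.

Lemma integral_prod_le (p : pred 'I_n) (g : X -> R) a :
  measurable_fun setT g -> (forall x, 0 <= g x) ->
  (\int[Q]_y (g y)%:E <= (expR a)%:E)%E ->
  (\int[P]_w (\prod_(i < n | p i) g (Xs i w))%:E <= (expR (#|p|%:R * a))%:E)%E.
Proof.
move=> mg g0 ga.
pose G (i : 'I_n) (x : n.-tuple X) (y : X) := if p i then g y * expR (- a) else 1.
have G0 i x y : 0 <= G i x y by rewrite /G; case: ifP => // _; rewrite mulr_ge0 ?expR_ge0.
have H : (\int[P]_w (1 * \prod_(i < n | (0 <= i)%N) G i (sample Xs w) (Xs i w))%:E <=
    \int[P]_w 1%:E)%E.
  apply: (@integral_chain _ _ _ _ _ P n Xs Q lawQ indep 0 (fun=> 1) G) => //.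
  - move=> i; rewrite /G; case: (p i); last exact: measurable_cst.
    apply: measurable_funM; last exact: measurable_cst.
    by apply: measurableT_comp mg _; exact: measurable_snd.
  - move=> i x; rewrite /G; case: (p i).
      under eq_integral do rewrite EFinM.
      rewrite ge0_integralZr//; last 2 first.
      + exact/measurable_EFinP.
      + by move=> y _; rewrite lee_fin.
      rewrite [leRHS](_ : _ = (expR a)%:E * (expR (- a))%:E)%E.
        by rewrite lee_wpmul2r// lee_fin expR_ge0.
      by rewrite -EFinM expRN mulfV// gt_eqF// expR_gt0.
    by rewrite integral_probability_cst.
have E1 w : \prod_(i < n | p i) g (Xs i w) =
    expR (#|p|%:R * a) * (1 * \prod_(i < n | (0 <= i)%N) G i (sample Xs w) (Xs i w)).
  rewrite mul1r /G -big_mkcond/= big_split/= prodr_const.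
  by rewrite mulrCA -expRM_natl -expRD mulrN subrr expR0 mulr1.
under eq_integral do rewrite E1 EFinM.
rewrite ge0_integralZl//; last 2 first.
- apply/measurable_EFinP; rewrite (_ : (fun w => _) = (fun w =>
    (expR (#|p|%:R * a))^-1 * \prod_(i < n | p i) g (Xs i w))).
    by apply: measurable_funM => //; exact: measurable_prod_sample.
  by apply/funext => w; rewrite E1 mulKf// gt_eqF// expR_gt0.
- by move=> w _; rewrite lee_fin mul1r prodr_ge0.
rewrite -[leRHS]mule1 lee_wpmul2l ?lee_fin ?expR_ge0//.
by apply: (le_trans H); rewrite integral_probability_cst.
Qed.

Context {M : nat} (f : 'I_M -> X -> R).
Hypothesis mf : forall j, measurable_fun setT (f j).
Hypothesis f0 : forall j x, 0 <= f j x.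
Hypothesis f1 : forall j, (\int[Q]_x (f j x)%:E <= 1)%E.
Variables (p : pred 'I_n) (nu : nat) (k0 : lattice (M:=M) nu).
Let m : R := #|p|%:R.
Hypothesis nu0 : (0 < nu)%N.
(** Rounding all coordinates up by at most one mesh step adds at most [M / nu] to the mass, and so
    at most 1 to [m * h]. *)
Hypothesis m_nu : m * M%:R <= nu%:R.
Hypothesis k0_ge1 : forall x, 1 <= mixture f (lattice_point k0) x.
Hypothesis k0_mass : mass (lattice_point k0 : _ -> R) <= 1 + M%:R / nu%:R.

Local Notation h := (hellinger Q f).
Local Notation lp := lattice_point.

(* The factor [expR (- m (mass u - 1))] extends the likelihood ratio to
   unnormalised [u]. *)
Definition lik_ratio2 (u : 'I_M -> R) (w : Omega) : R :=
  \prod_(i < n | p i) Num.sqrt (mixture f u (Xs i w)) *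
  expR (- (m * (mass u - 1) / 2)).

Definition lik_ratio4 (u : 'I_M -> R) (w : Omega) : R :=
  \prod_(i < n | p i) Num.sqrt (Num.sqrt (mixture f u (Xs i w))) *
  expR (- (m * (mass u - 1) / 4)).

Let m0 : 0 <= m. Proof. by rewrite ler0n. Qed.
Let nuR : 0 < nu%:R :> R. Proof. by rewrite ltr0n. Qed.
Let lp0 N (k : lattice N) j : 0 <= (lp k : 'I_M -> R) j. Proof. exact: lattice_point_ge0. Qed.
Let mMnu : m * (M%:R / nu%:R) <= 1.
Proof. by rewrite mulrA ler_pdivrMr// mul1r. Qed.

Lemma lik_ratio4_ge0 u w : 0 <= lik_ratio4 u w.
Proof. by rewrite mulr_ge0 ?expR_ge0// prodr_ge0// => i _; rewrite sqrtr_ge0. Qed.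

Lemma lik_ratio2_ge0 u w : 0 <= lik_ratio2 u w.
Proof. by rewrite mulr_ge0 ?expR_ge0// prodr_ge0// => i _; rewrite sqrtr_ge0. Qed.

(** AM-GM at each observation; the exponential corrections match exactly because [mass] is
    linear. *)
Lemma lik_ratio4_midpoint u v w : (forall j, 0 <= u j) -> (forall j, 0 <= v j) ->
  lik_ratio4 u w * lik_ratio4 v w <=
  lik_ratio2 (fun j => 2^-1 * u j + 2^-1 * v j) w.
Proof.
move=> u0 v0; rewrite /lik_ratio4 /lik_ratio2 mulrACA -big_split/= -expRD.
rewrite mass_lin.
rewrite (_ : - (m * (mass u - 1) / 4) - m * (mass v - 1) / 4 =
  - (m * (2^-1 * mass u + 2^-1 * mass v - 1) / 2)); last by lra.
rewrite ler_wpM2r ?expR_ge0//; apply: ler_prod => i _.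
rewrite mulr_ge0 ?sqrtr_ge0//= mixture_lin.
have F0 := mixture_ge0 (Xs i w) f0 u0; have G0 := mixture_ge0 (Xs i w) f0 v0.
move: (mixture f u _) (mixture f v _) F0 G0 => a b a0 b0.
rewrite -sqrtrM ?sqrtr_ge0//; apply: ler_wsqrtr.
have := sqr_sqrtr a0; have := sqr_sqrtr b0.
have := sqr_ge0 (Num.sqrt a - Num.sqrt b).
move: (Num.sqrt a) (Num.sqrt b) => s t; nra.
Qed.

(** A partition function: it roughly counts the lattice points with [m * h] bounded. *)
Definition lattice_weight N : R := \sum_(k : lattice (M:=M) N) expR (- (m * h (lp k) / 4)).

Lemma lattice_weight_refine J : (0 < J)%N ->
  lattice_weight (J * nu) <= expR (1 / 4) * J%:R ^+ M * lattice_weight nu.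
Proof.
move=> J0.
apply: (sum_lattice_refine (phi := fun u => expR (- (m * h u / 4)))) => //.
move=> u v u0 uv vu; rewrite -expRD ler_expR.
have hv := hellinger_mono mf f0 f1 u0 uv.
have mv : mass v - mass u <= M%:R / nu%:R.
  rewrite /mass -sumrB (@le_trans _ _ (\sum_(j < M) nu%:R^-1))//.
    by apply: ler_sum => j _; have := vu j; lra.
  by rewrite sumr_const card_ord -[leLHS]mulr_natl.
have : m * (h v) <= m * (h u + M%:R / nu%:R) by rewrite ler_wpM2l//; lra.
by have := mMnu; lra.
Qed.

Let mid (a b : lattice (M:=M) (3 * nu)) : lattice (M:=M) (6 * nu) :=
  [ffun j => inord (a j + b j)].

Let midE a b : lp (mid a b) = (fun j => 2^-1 * lp a j + 2^-1 * lp b j) :> ('I_M -> R).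
Proof.
apply/funext => j; rewrite /lattice_point ffunE inordK; last first.
  by have := ltn_ord (a j); have := ltn_ord (b j); lia.
rewrite natrD !natrM; field.
by rewrite gt_eqF.
Qed.

Let mid_inj a : injective (mid a).
Proof.
move=> b c /ffunP bc; apply/ffunP => j; apply/val_inj => /=.
have ? := ltn_ord (a j); have ? := ltn_ord (b j); have ? := ltn_ord (c j).
by have := congr1 (@nat_of_ord _) (bc j); rewrite !ffunE !inordK; lia.
Qed.

(* Contracting towards the rounded truth [k0] keeps the mixtures above 2/3, which
   makes negative powers of their likelihood integrable. *)
Let contract (s : lattice (M:=M) nu) : lattice (M:=M) (3 * nu) :=
  [ffun j => inord (2 * k0 j + s j)].

Let contractE s : lp (contract s) = (fun j => 2 / 3 * lp k0 j + 1 / 3 * lp s j) :> ('I_M -> R).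
Proof.
apply/funext => j; rewrite /lattice_point ffunE inordK; last first.
  by have := ltn_ord (k0 j); have := ltn_ord (s j); lia.
rewrite natrD !natrM; field.
by rewrite gt_eqF.
Qed.

Let contract_inj : injective contract.
Proof.
move=> b c /ffunP bc; apply/ffunP => j; apply/val_inj => /=.
have ? := ltn_ord (k0 j); have ? := ltn_ord (b j); have ? := ltn_ord (c j).
by have := congr1 (@nat_of_ord _) (bc j); rewrite !ffunE !inordK; lia.
Qed.

(** The weight spends half of the decay [expR (- m h / 2)] of the mean of [lik_ratio2]; what is left
    is exactly a summand of [lattice_weight]. *)
Definition lik_sum (w : Omega) : R :=
  \sum_(k : lattice (M:=M) (6 * nu)) expR (m * h (lp k) / 4) * lik_ratio2 (lp k) w.

Let wt (s : lattice (M:=M) nu) : R := expR (- (m * h (lp s) / 4)).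

Let v (s : lattice (M:=M) nu) (w : Omega) : R :=
  lik_ratio4 (lp (contract s)) w * expR (- (m * h (lp (contract s)) / 4)).

(* Chosen so that [(\sum_s wt s)^2 <= inv_lik_sum w * \sum_s v s w] by
   Cauchy-Schwarz. *)
Definition inv_lik_sum (w : Omega) : R := \sum_s wt s ^+ 2 / v s w.

Let mixture_contract s x :
  2 / 3 + mixture f (lp s) x / 3 <= mixture f (lp (contract s)) x.
Proof. by rewrite contractE mixture_lin; have := k0_ge1 x; lra. Qed.

Let v_gt0 s w : 0 < v s w.
Proof.
rewrite /v /lik_ratio4 !mulr_gt0 ?expR_gt0//; apply: prodr_gt0 => i _.
rewrite !sqrtr_gt0; apply: lt_le_trans (mixture_contract s _).
by have := mixture_ge0 (Xs i w) f0 (@lp0 _ s); lra.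
Qed.

Lemma measurable_lik_ratio2 u : measurable_fun setT (lik_ratio2 u).
Proof.
apply: measurable_funM => //.
apply: (@measurable_prod_sample p (fun x => Num.sqrt (mixture f u x))).
by apply: measurable_fun_sqrt; exact: measurable_mixture.
Qed.

Lemma measurable_lik_ratio4 u : measurable_fun setT (lik_ratio4 u).
Proof.
apply: measurable_funM => //.
apply: (@measurable_prod_sample p (fun x => Num.sqrt (Num.sqrt (mixture f u x)))).
by do 2! apply: measurable_fun_sqrt; exact: measurable_mixture.
Qed.

Lemma lik_sum_ge0 w : 0 <= lik_sum w.
Proof. by apply: sumr_ge0 => k _; rewrite mulr_ge0 ?expR_ge0 ?lik_ratio2_ge0. Qed.

Lemma inv_lik_sum_ge0 w : 0 <= inv_lik_sum w.
Proof. by apply: sumr_ge0 => s _; rewrite divr_ge0 ?sqr_ge0// ltW. Qed.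

Lemma measurable_lik_sum : measurable_fun setT lik_sum.
Proof.
apply: measurable_sum => k; apply: measurable_funM => //; exact: measurable_lik_ratio2.
Qed.

Let measurable_vV s : measurable_fun setT (fun w => (v s w)^-1).
Proof.
apply: measurable_fun_inv_ge0 => [|w]; last exact: ltW.
by apply: measurable_funM => //; exact: measurable_lik_ratio4.
Qed.

Lemma measurable_inv_lik_sum : measurable_fun setT inv_lik_sum.
Proof. by apply: measurable_sum => s; exact: measurable_funM. Qed.

Lemma integral_lik_ratio2 u : (forall j, 0 <= u j) ->
  (\int[P]_w (lik_ratio2 u w)%:E <= (expR (- (m * h u / 2)))%:E)%E.
Proof.
move=> u0.
pose g x := Num.sqrt (mixture f u x).
have mg : measurable_fun setT g by apply: measurable_fun_sqrt; exact: measurable_mixture.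
have H := @integral_prod_le p g ((mass u - 1) / 2 - h u / 2) mg (fun x => sqrtr_ge0 _).
under eq_integral do rewrite EFinM.
rewrite ge0_integralZr//; last 2 first.
- by apply/measurable_EFinP; exact: (measurable_prod_sample p mg).
- by move=> w _; rewrite lee_fin prodr_ge0// => i _; exact: sqrtr_ge0.
apply: (@le_trans _ _ ((expR (m * ((mass u - 1) / 2 - h u / 2)))%:E *
   (expR (- (m * (mass u - 1) / 2)))%:E)%E).
  rewrite lee_wpmul2r// ?lee_fin ?expR_ge0//; apply: H.
  rewrite /g integral_sqrt_mixture// lee_fin.
  by apply: le_trans (expR_ge1Dx _); lra.
by rewrite -EFinM -expRD lee_fin ler_expR; lra.
Qed.

Lemma integral_lik_sum : (\int[P]_w (lik_sum w)%:E <= (lattice_weight (6 * nu))%:E)%E.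
Proof.
apply: (@integral_sum_le _ _ _ P _ (fun k => expR (m * h (lp k) / 4))
  (fun k => lik_ratio2 (lp k)) (fun k => expR (- (m * h (lp k) / 2)))) => k.
- exact: expR_ge0.
- exact: measurable_lik_ratio2.
- by move=> w; exact: lik_ratio2_ge0.
- exact: (integral_lik_ratio2 (@lp0 _ k)).
- by rewrite -expRD ler_expR; lra.
Qed.

Lemma integral_inv_lik_sum :
  (\int[P]_w (inv_lik_sum w)%:E <= (expR (1 / 3) * lattice_weight nu)%:E)%E.
Proof.
rewrite /lattice_weight mulr_sumr.
(* In units of [m * h], the decay [1 / 2] of [wt s ^+ 2] pays for [1 / 8] from the negative moment
   and [1 / 12] from the weight of the contracted point; the remaining [7 / 24] exceeds [1 / 4]. The
   excess mass of [k0] enters twice, for [1 / 6] each time, and the mass of [lp s] cancels. *)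
apply: (@integral_sum_le _ _ _ P _ (fun s => wt s ^+ 2) (fun s w => (v s w)^-1)
  (fun s => expR (m * (h (lp s) / 8 + h (lp s) / 12) + 1 / 3))).
- by move=> s; exact: sqr_ge0.
- exact: measurable_vV.
- by move=> s w; rewrite invr_ge0 ltW.
- move=> s.
  have lps := @lp0 _ s; have lpc := @lp0 _ (contract s).
  pose u := lp s : 'I_M -> R; pose t := lp (contract s) : 'I_M -> R.
  pose g x := (Num.sqrt (Num.sqrt (mixture f t x)))^-1.
  have mg : measurable_fun setT g.
    apply: measurable_fun_inv_ge0 => [|x]; last exact: sqrtr_ge0.
    by do 2! apply: measurable_fun_sqrt; exact: measurable_mixture.
  have g0 x : 0 <= g x by rewrite invr_ge0 sqrtr_ge0.
  have H := @integral_prod_le p g (- ((mass u - 1) / 12) + h u / 8) mg g0.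
  have vE w : (v s w)^-1 = \prod_(i < n | p i) g (Xs i w) *
      expR (m * (mass t - 1) / 4 + m * h t / 4).
    by rewrite /v /lik_ratio4 !invfM -prodfV -!expRN !opprK -mulrA -expRD.
  under eq_integral do rewrite vE EFinM.
  rewrite ge0_integralZr//; last 2 first.
  + by apply/measurable_EFinP; exact: (measurable_prod_sample p mg).
  + by move=> w _; rewrite lee_fin prodr_ge0.
  apply: (@le_trans _ _ ((expR (m * (- ((mass u - 1) / 12) + h u / 8)))%:E *
     (expR (m * (mass t - 1) / 4 + m * h t / 4))%:E)%E).
    rewrite lee_wpmul2r// ?lee_fin ?expR_ge0//; apply: H.
    apply: (le_trans (integral_inv_sqrt4_le mf f0 f1 lps lpc (mixture_contract s))).
    by rewrite lee_fin; apply: le_trans (expR_ge1Dx _); rewrite -/u; lra.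
  rewrite -EFinM -expRD lee_fin ler_expR -/u.
  have ht := hellinger_contract mf f0 f1 lps lpc (mixture_contract s).
  have mt : mass t = 2 / 3 * mass (lp k0 : 'I_M -> R) + 1 / 3 * mass u.
    by rewrite /t contractE mass_lin.
  rewrite -/u -/t mt in ht.
  have q1 : m * mass (lp k0 : 'I_M -> R) <= m + 1.
    by have := ler_wpM2l m0 k0_mass; have := mMnu; lra.
  have q2 := ler_wpM2l m0 ht.
  by rewrite mt; lra.
- move=> s; rewrite /wt -expRM_natl -!expRD ler_expR.
  have := mulr_ge0 m0 (hellinger_ge0 mf f0 f1 (@lp0 _ s)); lra.
Qed.

(** Pairing [k] with every [t] gives [L * V <= lik_sum w], Cauchy-Schwarz gives
    [W <= V * (A * expR (1 / 3))], and [W] cancels from their combination. The rate [1 / 100] is the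
    weight [1 / 4] times the midpoint constant [1 / 25]. *)
Lemma lik_ratio4_bound A w (k : lattice (M:=M) (3 * nu)) : 0 < A ->
  lik_sum w <= A * (expR (1 / 4) * 6 ^+ M * lattice_weight nu) ->
  inv_lik_sum w <= A * (expR (1 / 3) * lattice_weight nu) ->
  lik_ratio4 (lp k) w * expR (m * h (lp k) / 100) <= A ^+ 2 * 6 ^+ M * expR 1.
Proof.
move=> A0 Psi_le U_le.
set W := lattice_weight nu in Psi_le U_le.
have W0 : 0 < W.
  rewrite /W /lattice_weight (bigD1 k0)//= ltr_pwDl ?expR_gt0//.
  by apply: sumr_ge0 => s _; exact: expR_ge0.
pose V := \sum_(t : lattice (M:=M) (3 * nu)) lik_ratio4 (lp t) w * expR (- (m * h (lp t) / 4)).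
set L := _ * _.
have L0 : 0 <= L by rewrite mulr_ge0 ?expR_ge0 ?lik_ratio4_ge0.
have LV : L * V <= lik_sum w.
  rewrite /V mulr_sumr.
  apply: (@le_trans _ _ (\sum_t
    (fun y => expR (m * h (lp y) / 4) * lik_ratio2 (lp y) w) (mid k t))).
    apply: ler_sum => t _.
    rewrite /L mulrACA -expRD [leRHS]mulrC midE ler_pM//.
    - by rewrite mulr_ge0 ?lik_ratio4_ge0.
    - by apply: lik_ratio4_midpoint; exact: lp0.
    rewrite ler_expR.
    have := ler_wpM2l m0 (hellinger_midpoint mf f0 f1 (@lp0 _ k) (@lp0 _ t)); lra.
  apply: (@ler_sum_inj _ _ _ (mid k) (fun y => expR (m * h (lp y) / 4) * lik_ratio2 (lp y) w)).
    exact: mid_inj.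
  by move=> y; rewrite mulr_ge0 ?expR_ge0 ?lik_ratio2_ge0.
have vV : \sum_s v s w <= V.
  apply: (@ler_sum_inj _ _ _ contract (fun t => lik_ratio4 (lp t) w * expR (- (m * h (lp t) / 4)))).
    exact: contract_inj.
  by move=> y; rewrite mulr_ge0 ?expR_ge0 ?lik_ratio4_ge0.
have V0 : 0 <= V by apply: le_trans vV; apply: sumr_ge0 => s _; exact: ltW.
have W2 : W ^+ 2 <= V * (A * (expR (1 / 3) * W)).
  apply: (@le_trans _ _ ((\sum_s v s w) * inv_lik_sum w)).
    by apply: sum_sqr_le_sumM_sumV => // s; exact: expR_ge0.
  by rewrite ler_pM ?inv_lik_sum_ge0// sumr_ge0// => s _; exact: ltW.
have WV : W <= V * (A * expR (1 / 3)).
  by move: W2; rewrite expr2 !mulrA ler_pM2r.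
rewrite -(@ler_pM2r _ W)//.
apply: (le_trans (ler_wpM2l L0 WV)); rewrite mulrA.
have E0 : 0 <= A * expR (1 / 3) by rewrite mulr_ge0 ?expR_ge0// ltW.
apply: (le_trans (ler_wpM2r E0 (le_trans LV Psi_le))).
have e1 : expR (1 / 4) * expR (1 / 3) <= expR 1 :> R by rewrite -expRD ler_expR; lra.
have P0 : 0 <= A ^+ 2 * 6 ^+ M * W.
  by rewrite !mulr_ge0 ?sqr_ge0 ?exprn_ge0 ?ltW.
rewrite [leRHS](_ : _ = expR 1 * (A ^+ 2 * 6 ^+ M * W)); last by ring.
by apply: le_trans (ler_wpM2r P0 e1); rewrite le_eqVlt; apply/orP; left; apply/eqP; ring.
Qed.

End likelihood_ratios.

(** * One-sided nets of convex hulls *)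

Section patterns.
Context (R : realType) (M : nat).

(* Truncated coordinate ratios to a near-maximal point of the hull; the bound on
   the ratios comes from first-order near-optimality of that point. *)
Definition pattern : Type := {ffun 'I_M -> 'I_(6 * M).+2}.
HB.instance Definition _ := Finite.on pattern.

(** A product prior whose coordinate sums telescope. It decays only polynomially in the ratios, so a
    bound on the product of [1 + ratio] bounds the weight from below. *)
Definition pattern_weight (k : pattern) : R :=
  \prod_j ((k j).+1%:R * (k j).+2%:R)^-1.

Lemma pattern_weight_gt0 k : 0 < pattern_weight k.
Proof. by apply: prodr_gt0 => j _; rewrite invr_gt0 mulr_gt0. Qed.

Lemma sum_pattern_weight_le1 : \sum_k pattern_weight k <= 1.
Proof.
rewrite /pattern_weight.
have -> : \sum_(k : pattern) \prod_j ((k j).+1%:R * (k j).+2%:R)^-1 =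
    \prod_(j < M) \sum_(i < (6 * M).+2) (i.+1%:R * i.+2%:R)^-1 :> R.
  by rewrite bigA_distr_bigA.
have tel K : \sum_(i < K) (i.+1%:R * i.+2%:R)^-1 = 1 - K.+1%:R^-1 :> R.
  elim: K => [|K IH]; first by rewrite big_ord0 invr1 subrr.
  rewrite big_ord_recr/= IH.
  have e : K.+2%:R = K.+1%:R + 1 :> R by rewrite natr1.
  rewrite e; field.
  by rewrite !gt_eqF//; have : 0 <= K%:R :> R by []; lra.
apply: prodr_ile1 => j _; rewrite tel gerBl invr_ge0 ler0n andbT.
by rewrite subr_ge0 invf_le1// ler1n.
Qed.

End patterns.

Section nash_center.
Context {R : realType} {M : nat} {I : finType} (pt : I -> 'I_M -> R) (T : {set I}).
Variable io : R.
Hypothesis io0 : 0 < io.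
Hypothesis pt01 : forall i j, 0 <= pt i j <= 1.
Hypothesis M0 : (0 < M)%N.

Definition convex_pred (D : ('I_M -> R) -> Prop) : Prop :=
  forall s u v, 0 <= s <= 1 -> D u -> D v -> D (fun j => s * u j + (1 - s) * v j).

(** Quantifying over convex predicates replaces explicit weights: a convex property of the points
    passes to the hull by one application. *)
Definition in_hull (u : 'I_M -> R) : Prop :=
  forall D, convex_pred D -> (forall i, i \in T -> D (pt i)) -> D u.

Lemma in_hull_pt i : i \in T -> in_hull (pt i).
Proof. by move=> iT D cD DT; exact: DT. Qed.

Lemma in_hull_conv s u v : 0 <= s <= 1 -> in_hull u -> in_hull v ->
  in_hull (fun j => s * u j + (1 - s) * v j).
Proof. by move=> s01 hu hv D cD DT; exact: cD s01 (hu D cD DT) (hv D cD DT). Qed.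

Lemma in_hull01 u j : in_hull u -> 0 <= u j <= 1.
Proof.
move=> /(_ (fun u => 0 <= u j <= 1)).
apply => [s a b /andP[s0 s1] /andP[a0 a1] /andP[b0 b1]|i _]; last exact: pt01.
by apply/andP; split; nra.
Qed.

Let vol (u : 'I_M -> R) : R := \prod_j (u j + io).

Let vol_gt0 u : in_hull u -> 0 < vol u.
Proof.
move=> hu; apply: prodr_gt0 => j _.
by have /andP[u0 _] := in_hull01 j hu; rewrite ltr_wpDl.
Qed.

(* Near-maximality up to a factor replaces the maximiser of [vol] on the closed
   hull, so that no compactness is needed. *)
Let near_max (c : 'I_M -> R) : Prop := forall i (s : R), i \in T -> 0 <= s <= 1 ->
  vol (fun j => s * pt i j + (1 - s) * c j) <= 2 * vol c.

(* Doubling [vol] must stop because [vol] is bounded on the hull. *)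
Lemma near_max_exists : (exists i, i \in T) -> exists2 c, in_hull c & near_max c.
Proof.
move=> [i0 i0T].
have volM u : in_hull u -> vol u <= (1 + io) ^+ M.
  move=> hu; rewrite -[X in _ ^+ X]card_ord -prodr_const; apply: ler_prod => j _.
  by have /andP[u0 u1] := in_hull01 j hu; rewrite addr_ge0 ?(ltW io0)//= lerD2r.
have H k : forall c, in_hull c -> (1 + io) ^+ M < 2 ^+ k * vol c ->
    exists2 c, in_hull c & near_max c.
  elim: k => [|k IH] c hc.
    by rewrite expr0 mul1r ltNge volM.
  have [cm _|cm big] := pselect (near_max c); first by exists c.
  move/existsNP : cm => [i /existsNP[s /not_implyP[iT /not_implyP[s01 /negP]]]].
  rewrite -ltNge => lt.
  apply: (IH _ (in_hull_conv s01 (in_hull_pt iT) hc)).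
  apply: (lt_trans big); rewrite exprSr -mulrA.
  by rewrite ltr_pM2l ?exprn_gt0.
have c0 := in_hull_pt i0T; have v0 := vol_gt0 c0.
pose b := (1 + io) ^+ M / vol (pt i0).
apply: (H (Num.truncn b).+1 (pt i0) c0).
rewrite -ltr_pdivrMr//; apply: (lt_trans (truncnS_gt b)).
by rewrite -natrX ltr_nat ltn_expl.
Qed.

Variable c : 'I_M -> R.
Hypothesis hc : in_hull c.
Hypothesis cmax : near_max c.

Let a i j := (pt i j + io) / (c j + io).

Let cio j : 0 < c j + io.
Proof. by have /andP[u0 _] := in_hull01 j hc; rewrite ltr_wpDl. Qed.

Let a0 i j : 0 <= a i j.
Proof.
by rewrite divr_ge0 ?(ltW (cio j))// addr_ge0 ?(ltW io0)//; case/andP: (pt01 i j).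
Qed.

Let prod_ratio_le i (s : R) : i \in T -> 0 <= s <= 1 -> \prod_j (1 - s + s * a i j) <= 2.
Proof.
move=> iT s01; have := cmax iT s01; rewrite -ler_pdivrMr ?vol_gt0//.
rewrite /vol -prodf_div; congr (_ <= _); apply: eq_bigr => j _.
by rewrite /a; field; rewrite gt_eqF.
Qed.

(** Near-maximality at the midpoint [s = 1 / 2]: large ratios cannot occur in many coordinates at
    once. *)
Lemma prod_ratio_bound i : i \in T -> \prod_j (1 + a i j) <= 2 ^+ M.+1.
Proof.
move=> iT; have := @prod_ratio_le i 2^-1 iT ltac:(apply/andP; split; lra).
rewrite (eq_bigr (fun j => (1 + a i j) / 2)); last by move=> j _; lra.
rewrite big_split/= prodr_const card_ord exprVn ler_pdivrMr ?exprn_gt0//.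
by rewrite exprS.
Qed.

Let bernoulli (s : R) k : 0 <= s <= 1 -> 1 - s * k%:R <= (1 - s) ^+ k :> R.
Proof.
move=> /andP[s0 s1]; elim: k => [|k IH]; first by rewrite mulr0 subr0 expr0.
rewrite exprSr; apply: le_trans (ler_wpM2r _ IH); last by lra.
have : 0 <= k%:R :> R by [].
rewrite -natr1; nra.
Qed.

(** With the short step [s = 1 / (2 * M)] the other coordinates together lose at most a factor 2, so
    one ratio beyond [6 * M + 1] would already violate near-maximality. *)
Lemma ratio_bound i j : i \in T -> a i j <= 6 * M%:R + 1.
Proof.
move=> iT; have MR : 0 < M%:R :> R by rewrite ltr0n.
have M1 : 1 <= M%:R :> R by rewrite ler1n.
pose s : R := (2 * M%:R)^-1.
have sM : s * M%:R = 2^-1 by rewrite /s; field; rewrite gt_eqF.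
have s0 : 0 < s by rewrite invr_gt0 mulr_gt0.
have s1 : s <= 1 by nra.
have s01 : 0 <= s <= 1 by rewrite s1 ltW.
have := prod_ratio_le iT s01.
rewrite (bigD1 j)//=.
have rest : 2^-1 <= \prod_(k | k != j) (1 - s + s * a i k).
  apply: (@le_trans _ _ ((1 - s) ^+ M)).
    by have := bernoulli M s01; rewrite sM; lra.
  rewrite -[X in _ ^+ X](card_ord M) -prodr_const (bigD1 j)//=.
  apply: (@le_trans _ _ (\prod_(k < M | k != j) (1 - s))).
    rewrite ler_piMl ?gerBl ?(ltW s0)// prodr_ge0// => k _; lra.
  apply: ler_prod => k _; apply/andP; split; first by lra.
  by rewrite lerDl mulr_ge0// ltW.
have aj := a0 i j.
have f0 : 0 <= 1 - s + s * a i j by nra.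
move=> H; have : (1 - s + s * a i j) * 2^-1 <= 2.
  by apply: le_trans H; rewrite ler_wpM2l.
move=> {H} H; have {}H : s * a i j <= 3 + s by lra.
rewrite -(ler_pM2l s0); apply: (le_trans H).
by rewrite mulrDr mulr1 mulrCA sM; lra.
Qed.

Let pattern_of i : pattern M := [ffun j => inord (Num.truncn (a i j))].

Let pattern_ofE i j : i \in T -> pattern_of i j = Num.truncn (a i j) :> nat.
Proof.
move=> iT; rewrite ffunE inordK// ltnS -(ler_nat R).
have /andP[l _] := truncn_itv (a0 i j); apply: (le_trans l).
by apply: (le_trans (ratio_bound j iT)); rewrite -[X in _ <= X%:R]addn1 natrD natrM.
Qed.

Let rep (k : pattern M) : 'I_M -> R :=
  if [pick i in T | pattern_of i == k] is Some i then pt i else c.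

Let rep_hull k : in_hull (rep k).
Proof. by rewrite /rep; case: pickP => // i /andP[iT _]; exact: in_hull_pt. Qed.

(** The half of [c] makes each cell dominate all points of [T] up to a factor O(M); the half of the
    representative makes it dominate the points of its own pattern up to a constant. *)
Let cell (k : pattern M) : 'I_M -> R := fun j => 2^-1 * rep k j + (1 - 2^-1) * c j.

Lemma cell_hull k : in_hull (cell k).
Proof. by apply: in_hull_conv => //; apply/andP; split; lra. Qed.

Lemma cell_dominates i k j : i \in T -> pt i j <= (12 * M%:R + 2) * (cell k j + io).
Proof.
move=> iT; have := ratio_bound j iT; rewrite ler_pdivrMr// => H.
have /andP[r0 _] := in_hull01 j (rep_hull k).
have MR : 0 <= M%:R :> R by [].
have : 0 <= (6 * M%:R + 1) * (rep k j + io) by rewrite mulr_ge0 ?addr_ge0 ?mulr_ge0 ?(ltW io0).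
by rewrite /cell; move: H io0; lra.
Qed.

(** Equal integer parts give [1 + a i j <= 2 * (1 + a i' j)]; multiplied by [c j + io], the right
    side becomes four times the shifted cell. *)
Lemma cell_of_pattern i j : i \in T -> pt i j <= 4 * (cell (pattern_of i) j + io).
Proof.
move=> iT; rewrite /cell /rep; case: pickP => [i' /andP[i'T /eqP e]|/(_ i)]; last first.
  by rewrite iT eqxx.
have e1 : Num.truncn (a i j) = Num.truncn (a i' j) by rewrite -!pattern_ofE// e.
have /andP[_ l1] := truncn_itv (a0 i j).
have /andP[l2 _] := truncn_itv (a0 i' j).
rewrite e1 -natr1 in l1.
have t0 : 0 <= (Num.truncn (a i' j))%:R :> R by [].
have aa : 1 + a i j <= 2 * (1 + a i' j) by lra.
have ea i1 : a i1 j * (c j + io) = pt i1 j + io by rewrite mulfVK// gt_eqF.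
have := ler_wpM2r (ltW (cio j)) aa.
by move: io0 (cio j) (ea i) (ea i'); lra.
Qed.

Lemma pattern_of_weight i : i \in T ->
  (2 ^+ (3 * M + 2))^-1 <= pattern_weight R (pattern_of i).
Proof.
move=> iT; have B := prod_ratio_bound iT.
have B0 : 0 <= \prod_j (1 + a i j) by rewrite prodr_ge0// => j _; rewrite addr_ge0.
rewrite /pattern_weight prodfV lef_pV2 ?posrE ?exprn_gt0//; last first.
  by apply: prodr_gt0 => j _; rewrite mulr_gt0.
(* An integer part [t] satisfies [t.+1 * t.+2 <= 2 * (1 + a i j) ^+ 2], so the exponent is
   [M + 2 * (M + 1)]. *)
apply: (@le_trans _ _ (\prod_j (2 * (1 + a i j) ^+ 2))).
  apply: ler_prod => j _; rewrite mulr_ge0//= pattern_ofE//.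
  have /andP[l _] := truncn_itv (a0 i j).
  have t0 : 0 <= (Num.truncn (a i j))%:R :> R by [].
  rewrite -natr1 -[in X in _ * X <= _]natr1 -natr1; have := a0 i j; nra.
rewrite big_split/= prodr_const card_ord prodrXl.
apply: (@le_trans _ _ (2 ^+ M * (2 ^+ M.+1) ^+ 2)).
  by rewrite ler_wpM2l ?exprn_ge0// ler_pXn2r ?nnegrE ?exprn_ge0.
by rewrite -exprM -exprD ler_weXn2l// ?ler1n//; lia.
Qed.

End nash_center.

Lemma one_sided_net (R : realType) (M : nat) (I : finType) (pt : I -> 'I_M -> R)
    (T : {set I}) (io : R) : 0 < io -> (forall i j, 0 <= pt i j <= 1) ->
  (0 < M)%N -> (exists i, i \in T) ->
  exists y : pattern M -> 'I_M -> R,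
    [/\ forall k, in_hull pt T (y k),
        forall i, i \in T -> exists2 k, (2 ^+ (3 * M + 2))^-1 <= pattern_weight R k &
           forall j, pt i j <= 4 * (y k j + io) &
        forall i k j, i \in T -> pt i j <= (12 * M%:R + 2) * (y k j + io)].
Proof.
move=> io0 pt01 M0 Tne.
have [c hc cmax] := near_max_exists io0 pt01 Tne.
eexists; split.
- by move=> k; exact: (cell_hull io hc).
- move=> i iT; eexists; first exact: (pattern_of_weight io0 pt01 M0 hc cmax iT).
  by move=> j; exact: cell_of_pattern.
- by move=> i k j iT; exact: cell_dominates.
Qed.

(** * Sequential Bayes prediction *)

Section bayes_prediction.
Context {R : realType} {X : Type} {K : finType} (w : K -> R) (g : K -> X -> R).
Variables (n m : nat).
Implicit Types (x : n.-tuple X) (y : X).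

Definition bayes_evidence (t : nat) x : R :=
  \sum_k w k * \prod_(i < n | (m <= i < t)%N) g k (tnth x i).

Definition bayes_predictive (t : nat) x y : R :=
  (\sum_k w k * \prod_(i < n | (m <= i < t)%N) g k (tnth x i) * g k y) /
  bayes_evidence t x.

(** Online-to-batch conversion: by concavity a single averaged density inherits the cumulative bound
    of the successive predictors. *)
Definition bayes_average x y : R :=
  (\sum_(t < n | (m <= t)%N) bayes_predictive t x y) / (n - m)%:R.

Lemma card_ge : (m <= n)%N -> #|[pred t : 'I_n | (m <= t)%N]| = (n - m)%N.
Proof.
move=> _; rewrite -sum1_card.
have := @big_geq_mkord _ 0%N addn m n xpredT (fun=> 1%N).
by rewrite sum_nat_const_nat muln1 => ->; apply: eq_bigl.
Qed.

Lemma bayes_evidenceS (k : 'I_n) x : (m <= k)%N ->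
  bayes_evidence k.+1 x =
  \sum_l w l * \prod_(i < n | (m <= i < k)%N) g l (tnth x i) * g l (tnth x k).
Proof.
move=> mk; apply: eq_bigr => l _; rewrite (bigD1 k) /= ?mk ?ltnSn//.
rewrite -mulrA [g l _ * _]mulrC; congr (_ * (_ * _)).
apply: eq_bigl => i; rewrite ltnS (leq_eqVlt i k) -val_eqE /=.
by case: (ltngtP i k); rewrite ?andbT ?andbF.
Qed.

Hypothesis w_gt0 : forall k, 0 < w k.
Hypothesis w_sum : \sum_k w k = 1.

Lemma bayes_evidence_gt0 t x : (forall k (i : 'I_n), 0 < g k (tnth x i)) ->
  0 < bayes_evidence t x.
Proof.
move=> gx; have [k0 _] : exists k : K, true.
  apply/existsP; rewrite -[[exists _, _]]negbK; apply/negP => /existsPn H.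
  have : \sum_k w k = 0 by apply: big1 => k _; have := H k.
  by rewrite w_sum => /eqP; rewrite oner_eq0.
rewrite /bayes_evidence (bigD1 k0)//= ltr_pwDl ?mulr_gt0 ?prodr_gt0//.
by apply: sumr_ge0 => k _; rewrite mulr_ge0 ?prodr_ge0// => [|i _]; exact: ltW.
Qed.

Lemma bayes_evidence_start x : bayes_evidence m x = 1.
Proof.
rewrite -[RHS]w_sum; apply: eq_bigr => k _; rewrite big_pred0 ?mulr1// => i.
by case: leqP => //= mi; rewrite ltnNge mi.
Qed.

(* Bayesian log-loss telescopes. *)
Lemma prod_bayes_predictive x : (m <= n)%N -> (forall k (i : 'I_n), 0 < g k (tnth x i)) ->
  \prod_(t < n | (m <= t)%N) bayes_predictive t x (tnth x t) = bayes_evidence n x.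
Proof.
move=> mn gx.
have e0 t := bayes_evidence_gt0 t gx.
have H j : (m <= j <= n)%N ->
    \prod_(t < n | (m <= t < j)%N) bayes_predictive t x (tnth x t) = bayes_evidence j x.
  elim: j => [|j IH] /andP[mj jn].
    have -> : m = 0%N by lia.
    rewrite big_pred0 => [|i]; last by rewrite ltn0 andbF.
    by have := bayes_evidence_start x; have -> : m = 0%N by lia.
  have [mj'|jm] := leqP m j; last first.
    have -> : j.+1 = m by lia.
    rewrite bayes_evidence_start big_pred0// => i.
    by case: leqP => //= mi; rewrite ltnNge mi.
  rewrite (bigD1 (Ordinal jn))/= ?mj' ?ltnSn//.
  rewrite (eq_bigl (fun t : 'I_n => (m <= t < j)%N)); last first.
    move=> i; rewrite ltnS (leq_eqVlt i j) -val_eqE /=.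
    by case: (ltngtP i j); rewrite ?andbT ?andbF.
  rewrite IH; last by rewrite mj' (ltnW jn).
  rewrite /bayes_predictive/= -(bayes_evidenceS (k := Ordinal jn))//= divfK//.
  by rewrite gt_eqF.
by rewrite -H ?mn ?leqnn//; apply: eq_bigl => i; rewrite ltn_ord andbT.
Qed.

End bayes_prediction.

(** * Supermartingale bound for the averaged predictor *)

Section sequential_bound.
Context {R : realType} {d} {X : measurableType d} {K : finType}
  (Q : probability X R) (w : K -> R) (g : K -> X -> R) (n m : nat) (B eta : R).
Hypothesis w_gt0 : forall k, 0 < w k.
Hypothesis w_sum : \sum_k w k = 1.
Hypothesis mg : forall k, measurable_fun setT (g k).
Hypothesis g1 : forall k, (\int[Q]_y (g k y)%:E <= 1)%E.
Hypothesis B1 : 1 <= B.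
Hypothesis gB : forall k y, B^-1 <= g k y.
Hypothesis eta_B : eta * (12 + 6 * ln B) = 1.
Hypothesis mn : (m < n)%N.

Local Notation pred_ := (bayes_predictive w g m).
Local Notation ev := (bayes_evidence w g m).
Local Notation avg := (bayes_average w g m).

Let B0 : 0 < B. Proof. by apply: lt_le_trans B1. Qed.

Let g_gt0 k y : 0 < g k y.
Proof. by apply: lt_le_trans (gB k y); rewrite invr_gt0. Qed.

Let eta0 : 0 < eta.
Proof.
have lB := ln_ge0 B1.
by rewrite -(pmulr_lgt0 _ (_ : 0 < 12 + 6 * ln B)) ?eta_B//; lra.
Qed.

Let eta1 : eta <= 1.
Proof. by have := ln_ge0 B1; have := eta0; have := eta_B; nra. Qed.

Let ev_gt0 t (x : n.-tuple X) : 0 < ev t x.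
Proof. exact: bayes_evidence_gt0. Qed.

Lemma predictive_ge t (x : n.-tuple X) y : B^-1 <= pred_ t x y.
Proof.
rewrite /bayes_predictive ler_pdivlMr// /bayes_evidence mulr_sumr.
apply: ler_sum => k _; rewrite mulrC ler_wpM2l// mulr_ge0 ?(ltW (w_gt0 k))//.
by rewrite prodr_ge0// => i _; exact: ltW.
Qed.

Let pred_gt0 t (x : n.-tuple X) y : 0 < pred_ t x y.
Proof. by apply: lt_le_trans (predictive_ge t x y); rewrite invr_gt0. Qed.

Lemma measurable_evidence t : measurable_fun setT (fun x : n.-tuple X => ev t x).
Proof.
apply: measurable_sum => k; apply: measurable_funM => //.
under eq_fun do rewrite -big_filter; apply: measurable_prod => i _.
by apply: measurableT_comp (mg k) _; exact: measurable_tnth.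
Qed.

Lemma measurable_predictive t :
  measurable_fun setT (fun z : n.-tuple X * X => pred_ t z.1 z.2).
Proof.
apply: measurable_funM.
  apply: measurable_sum => k; apply: measurable_funM; last first.
    exact: measurableT_comp (mg k) measurable_snd.
  apply: measurable_funM => //.
  under eq_fun do rewrite -big_filter; apply: measurable_prod => i _.
  apply: measurableT_comp (mg k) _.
  have := @measurable_tnth _ X n i => H.
  exact: measurableT_comp H measurable_fst.
apply: measurable_fun_inv_ge0; last by move=> z; exact: ltW.
exact: measurableT_comp (measurable_evidence t) measurable_fst.
Qed.

Lemma measurable_predictive_y t (x : n.-tuple X) : measurable_fun setT (pred_ t x).
Proof.
have mh : measurable_fun setT (fun y : X => (x, y)) by exact: measurable_fun_pair.
exact: measurableT_comp (measurable_predictive t) mh.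
Qed.

Lemma integral_predictive_le1 t (x : n.-tuple X) : (\int[Q]_y (pred_ t x y)%:E <= 1)%E.
Proof.
pose c k := w k * \prod_(i < n | (m <= i < t)%N) g k (tnth x i) / ev t x.
have c0 k : 0 <= c k.
  rewrite divr_ge0 ?(ltW (ev_gt0 _ _))// mulr_ge0 ?(ltW (w_gt0 k))//.
  by rewrite prodr_ge0// => i _; exact: ltW.
have -> : (1 = (\sum_k c k)%:E)%E.
  by rewrite /c -mulr_suml -/(ev t x) mulfV ?gt_eqF.
have E y : pred_ t x y = \sum_k c k * g k y.
  by rewrite /bayes_predictive mulr_suml; apply: eq_bigr => k _; rewrite /c mulrAC.
under eq_integral do rewrite E.
apply: (@integral_sum_le _ _ _ Q K c g (fun=> 1) c) => //.
- by move=> k y; exact: ltW.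
- by move=> k; rewrite mulr1.
Qed.

Definition predictive_moment t (x : n.-tuple X) : R := \int[Q]_y (pred_ t x y `^ eta).

Let mpow t (x : n.-tuple X) : measurable_fun setT (fun y => pred_ t x y `^ eta).
Proof. exact: measurableT_comp (measurable_powR eta) (measurable_predictive_y t x). Qed.

Let pow_integrable (u : X -> R) : measurable_fun setT u -> (forall y, 0 < u y) ->
  (\int[Q]_y (u y)%:E <= 1)%E -> Q.-integrable setT (EFin \o (fun y => u y `^ eta)).
Proof.
move=> mu_ u0 u1.
have iu : Q.-integrable setT (EFin \o u).
  apply/integrableP; split; first exact/measurable_EFinP.
  under eq_integral do rewrite /= gtr0_norm//.
  by apply: le_lt_trans u1 _; rewrite ltry.
have ic : Q.-integrable setT (EFin \o cst (1 : R)).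
  exact: finite_measure_integrable_cst.
apply: (le_integrable measurableT _ _ (integrableD measurableT ic iu)).
  by apply/measurable_EFinP; exact: measurableT_comp (measurable_powR eta) mu_.
move=> y _ /=; rewrite lee_fin ger0_norm ?powR_ge0//.
have uy := u0 y; rewrite ger0_norm; last by lra.
by have := powR_bernoulli (ltW eta0) eta1 uy; have := eta0; have := eta1; nra.
Qed.

Let predictive_momentE t (x : n.-tuple X) :
  (\int[Q]_y (pred_ t x y `^ eta)%:E)%E = (predictive_moment t x)%:E.
Proof.
rewrite /predictive_moment /Rintegral fineK//; apply: integrable_fin_num => //.
apply: pow_integrable => //; first exact: measurable_predictive_y.
exact: integral_predictive_le1.
Qed.

Lemma measurable_predictive_moment t : measurable_fun setT (predictive_moment t).
Proof.
pose F (z : n.-tuple X * X) : \bar R := (pred_ t z.1 z.2 `^ eta)%:E.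
have mF : measurable_fun setT F.
  apply/measurable_EFinP.
  exact: measurableT_comp (measurable_powR eta) (measurable_predictive t).
have F0 z : (0 <= F z)%E by rewrite lee_fin powR_ge0.
apply/measurable_EFinP.
rewrite (_ : EFin \o _ = (fun x => \int[Q]_y F (x, y)))%E.
  exact: measurable_fun_fubini_tonelli_F.
by apply/funext => x /=; rewrite -predictive_momentE.
Qed.

(** Its conditional mean is [a * expR (1 - a) <= 1], where [a] is the moment; the exponent turns the
    product into a sum of gaps [1 - a]. *)
Definition predictive_factor (t : 'I_n) (x : n.-tuple X) (y : X) : R :=
  pred_ t x y `^ eta * expR (1 - predictive_moment t x).

Lemma measurable_predictive_factor t :
  measurable_fun setT (fun z : n.-tuple X * X => predictive_factor t z.1 z.2).
Proof.
apply: measurable_funM.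
  exact: measurableT_comp (measurable_powR eta) (measurable_predictive t).
apply: measurableT_comp => //; apply: measurable_funB => //.
exact: measurableT_comp (measurable_predictive_moment t) measurable_fst.
Qed.

Lemma predictive_factor_ge0 t x y : 0 <= predictive_factor t x y.
Proof. by rewrite mulr_ge0 ?powR_ge0 ?expR_ge0. Qed.

Lemma predictive_prefix (t : 'I_n) y : prefix_dependent t (fun x : n.-tuple X => pred_ t x y).
Proof.
move=> x x' xx'.
have H k : \prod_(i < n | (m <= i < t)%N) g k (tnth x i) =
           \prod_(i < n | (m <= i < t)%N) g k (tnth x' i).
  by apply: eq_bigr => i /andP[_ it]; rewrite xx'.
rewrite /bayes_predictive /bayes_evidence.
by congr (_ / _); apply: eq_bigr => k _; rewrite H.
Qed.

Lemma predictive_factor_prefix (t : 'I_n) y : prefix_dependent t (predictive_factor t ^~ y).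
Proof.
move=> x x' xx'; rewrite /predictive_factor (predictive_prefix _ xx').
rewrite /predictive_moment; congr (_ * expR (1 - _)).
by apply: eq_Rintegral => z _; rewrite (predictive_prefix _ xx').
Qed.

Lemma integral_predictive_factor t x : (\int[Q]_y (predictive_factor t x y)%:E <= 1)%E.
Proof.
rewrite /predictive_factor; under eq_integral do rewrite EFinM.
rewrite ge0_integralZr//; last 2 first.
- exact/measurable_EFinP/mpow.
- by move=> y _; rewrite lee_fin powR_ge0.
rewrite predictive_momentE -EFinM lee_fin.
rewrite -[leRHS](expRxMexpNx_1 (predictive_moment t x - 1)) opprB.
by rewrite ler_wpM2r ?expR_ge0//; apply: le_trans (expR_ge1Dx _); lra.
Qed.

Lemma prod_predictive_factor (x : n.-tuple X) :
  \prod_(t < n | (m <= t)%N) predictive_factor t x (tnth x t) =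
  ev n x `^ eta * expR (\sum_(t < n | (m <= t)%N) (1 - predictive_moment t x)).
Proof.
rewrite /predictive_factor big_split/= -expR_sum; congr (_ * _).
rewrite -(prod_bayes_predictive w_gt0 w_sum (ltnW mn) (fun k i => g_gt0 k _)).
suff [] : 0 <= \prod_(t < n | (m <= t)%N) pred_ t x (tnth x t) /\
  \prod_(t < n | (m <= t)%N) pred_ t x (tnth x t) `^ eta =
  (\prod_(t < n | (m <= t)%N) pred_ t x (tnth x t)) `^ eta by [].
elim/big_rec2 : _ => [|t a b _ [b0 ->]]; first by rewrite powR1.
have p0 := ltW (pred_gt0 t x (tnth x t)).
by split; [rewrite mulr_ge0|rewrite powRM].
Qed.

Let N : R := (n - m)%:R.
Let N0 : 0 < N. Proof. by rewrite ltr0n subn_gt0. Qed.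

Let sum_const_ge (c : R) : \sum_(t < n | (m <= t)%N) c = N * c.
Proof. by rewrite sumr_const card_ge ?(ltnW mn)// -[LHS]mulr_natl. Qed.

Lemma average_ge (x : n.-tuple X) y : B^-1 <= avg x y.
Proof.
rewrite /bayes_average ler_pdivlMr// mulrC -sum_const_ge.
by apply: ler_sum => t _; exact: predictive_ge.
Qed.

Let avg_gt0 (x : n.-tuple X) y : 0 < avg x y.
Proof. by apply: lt_le_trans (average_ge x y); rewrite invr_gt0. Qed.

Lemma measurable_average (x : n.-tuple X) : measurable_fun setT (avg x).
Proof.
apply: measurable_funM => //.
under eq_fun do rewrite -big_filter; apply: measurable_sum => t.
exact: measurable_predictive_y.
Qed.

Lemma integral_average_le1 (x : n.-tuple X) : (\int[Q]_y (avg x y)%:E <= 1)%E.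
Proof.
have E y : avg x y = \sum_(t < n) (if (m <= t)%N then N^-1 else 0) * pred_ t x y.
  rewrite /bayes_average big_mkcond/= mulr_suml; apply: eq_bigr => t _.
  by case: ifP => _; rewrite ?mul0r// mulrC.
have S1 : 1 = \sum_(t < n) (if (m <= t)%N then N^-1 else 0).
  by rewrite -big_mkcond sum_const_ge mulfV// gt_eqF.
under eq_integral do rewrite E.
rewrite [leRHS](_ : _ = (\sum_(t < n) (if (m <= t)%N then N^-1 else 0))%:E); last by rewrite -S1.
apply: (@integral_sum_le _ _ _ Q 'I_n (fun t => if (m <= t)%N then N^-1 else 0)
  (fun t => pred_ t x) (fun=> 1)) => //.
- by move=> t; case: ifP => // _; rewrite invr_ge0 ltW.
- by move=> t; exact: measurable_predictive_y.
- by move=> t y; exact: ltW.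
- by move=> t; exact: integral_predictive_le1.
- by move=> t; rewrite mulr1.
Qed.

Let iavg (x : n.-tuple X) : Q.-integrable setT (EFin \o avg x).
Proof.
apply/integrableP; split; first by apply/measurable_EFinP; exact: measurable_average.
under eq_integral do rewrite /= gtr0_norm//.
by apply: le_lt_trans (integral_average_le1 x) _; rewrite ltry.
Qed.

Let ipow t (x : n.-tuple X) : Q.-integrable setT (EFin \o (fun y => pred_ t x y `^ eta)).
Proof.
apply: pow_integrable => //; first exact: measurable_predictive_y.
exact: integral_predictive_le1.
Qed.

Let ipow_avg (x : n.-tuple X) : Q.-integrable setT (EFin \o (fun y => avg x y `^ eta)).
Proof.
apply: pow_integrable => //; first exact: measurable_average.
exact: integral_average_le1.
Qed.

(* Concavity of [z `^ eta] through its tangent at [avg x y]. *)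
Lemma sum_predictive_moment_le (x : n.-tuple X) :
  \sum_(t < n | (m <= t)%N) predictive_moment t x <= N * \int[Q]_y (avg x y `^ eta).
Proof.
rewrite /predictive_moment.
have -> : \sum_(t < n | (m <= t)%N) \int[Q]_y (pred_ t x y `^ eta) =
    \int[Q]_y (\sum_(t < n | (m <= t)%N) pred_ t x y `^ eta).
  have aux (s : seq 'I_n) : \sum_(t <- s) \int[Q]_y (pred_ t x y `^ eta) =
      \int[Q]_y (\sum_(t <- s) pred_ t x y `^ eta).
    elim: s => [|t s IH].
      under eq_Rintegral do rewrite big_nil.
      by rewrite big_nil Rintegral_cst// mul0r.
    under eq_Rintegral do rewrite big_cons.
    rewrite big_cons IH -RintegralD//.
    rewrite (_ : EFin \o _ = (fun y => \sum_(t <- s) (pred_ t x y `^ eta)%:E)%E).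
      by apply: integrable_sum => // t0 _; exact: ipow.
    by apply/funext => y /=; rewrite sumEFin.
  by rewrite -big_filter aux; apply: eq_Rintegral => y _; rewrite big_filter.
rewrite -RintegralZl//; apply: le_Rintegral => //.
- rewrite (_ : EFin \o _ = (fun y => \sum_(t < n | (m <= t)%N) (pred_ t x y `^ eta)%:E)%E).
    by apply: integrable_sum => // t0 _; exact: ipow.
  by apply/funext => y /=; rewrite sumEFin.
- exact: integrable_scale.
move=> y _; have a0 := avg_gt0 x y.
have tangent t : pred_ t x y `^ eta <=
    avg x y `^ eta * (1 + eta * (pred_ t x y / avg x y - 1)).
  have := powR_bernoulli (ltW eta0) eta1 (divr_gt0 (pred_gt0 t x y) a0).
  move=> /(ler_wpM2l (powR_ge0 (avg x y) eta)).
  rewrite -powRM ?(ltW a0) ?(ltW (divr_gt0 (pred_gt0 t x y) a0))//.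
  by rewrite mulrCA mulfV ?gt_eqF// mulr1.
apply: (@le_trans _ _ (\sum_(t < n | (m <= t)%N)
    avg x y `^ eta * (1 + eta * (pred_ t x y / avg x y - 1)))).
  by apply: ler_sum => t _; exact: tangent.
rewrite -mulr_sumr big_split/= sum_const_ge -mulr_sumr sumrB sum_const_ge.
rewrite -mulr_suml.
have -> : \sum_(t < n | (m <= t)%N) pred_ t x y = N * avg x y.
  by rewrite /bayes_average mulrC divfK// gt_eqF.
by rewrite mulfK ?gt_eqF// !mulr1 subrr mulr0 addr0 mulrC.
Qed.

Lemma integrable_ln_average (x : n.-tuple X) :
  Q.-integrable setT (EFin \o (fun y => ln (avg x y))).
Proof.
have ic : Q.-integrable setT (EFin \o cst (ln B)) by exact: finite_measure_integrable_cst.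
apply: (le_integrable measurableT _ _ (integrableD measurableT ic (iavg x))).
  by apply/measurable_EFinP; exact: measurableT_comp (@measurable_ln R) (measurable_average x).
move=> y _ /=; have a0 := avg_gt0 x y; have lB := ln_ge0 B1.
rewrite lee_fin [leRHS]ger0_norm ?addr_ge0 ?(ltW a0)//.
rewrite ler_norml; apply/andP; split.
  have : ln B^-1 <= ln (avg x y) by rewrite ler_ln ?posrE ?invr_gt0 ?average_ge.
  by rewrite lnV ?posrE//; lra.
by have := ln_sublinear a0; lra.
Qed.

Lemma Rintegral_ln_average_le (x : n.-tuple X) A : 0 < A ->
  \prod_(t < n | (m <= t)%N) predictive_factor t x (tnth x t) <= A ->
  \int[Q]_y (- ln (avg x y)) <= 3 / N * (ln A / eta - ln (ev n x)).
Proof.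
move=> A0; rewrite prod_predictive_factor => H.
have e0 := ev_gt0 n x.
have lnA : eta * ln (ev n x) + \sum_(t < n | (m <= t)%N) (1 - predictive_moment t x) <= ln A.
  rewrite -ler_expR expRD lnK ?posrE//; apply: le_trans H.
  by rewrite /powR gt_eqF.
move: lnA; rewrite sumrB sum_const_ge mulr1 => lnA.
have J := sum_predictive_moment_le x.
set S := \sum_(_ < n | _) _ in lnA J.
have step : \int[Q]_y (- ln (avg x y)) <= 3 / eta * (1 - \int[Q]_y (avg x y `^ eta)).
  have i1 : Q.-integrable setT (EFin \o cst (3 / eta - 2)) by exact: finite_measure_integrable_cst.
  have i2 := integrable_scale (- (3 / eta)) (ipow_avg x).
  have i3 := integrable_scale 2 (iavg x).
  have i4 := integrable_opp (integrable_ln_average x).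
  apply: (@le_trans _ _ (\int[Q]_y (cst (3 / eta - 2) y +
      (- (3 / eta) * avg x y `^ eta + 2 * avg x y)))).
    apply: le_Rintegral => //.
      exact: integrable_add i1 (integrable_add i2 i3).
    move=> y _ /=.
    by have := neg_ln_le_powR B1 (average_ge x y) eta_B; lra.
  rewrite RintegralD//; last exact: integrable_add i2 i3.
  rewrite Rintegral_cst// RintegralD//.
  rewrite (RintegralZl _ measurableT (ipow_avg x)) (RintegralZl _ measurableT (iavg x)).
  rewrite [X in fine X](_ : _ = 1%E); last exact: (@probability_setT _ _ _ Q).
  have : \int[Q]_y avg x y <= 1.
    rewrite -lee_fin fineK; first exact: integral_average_le1.
    exact: (integrable_fin_num _ (iavg x)).
  by rewrite /=; lra.
apply: (le_trans step).
have {lnA} : N * (1 - \int[Q]_y (avg x y `^ eta)) <= ln A - eta * ln (ev n x) by lra.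
have c0 : 0 <= 3 / eta / N by rewrite !divr_ge0 ?ltW.
move=> /(ler_wpM2l c0).
rewrite mulrA divfK ?gt_eqF// => /le_trans; apply.
by rewrite le_eqVlt; apply/orP; left; apply/eqP; field; rewrite !gt_eqF.
Qed.

End sequential_bound.

(** * Change of density *)

Section density.
Import HBNNSimple.
Context {R : realType} {d} {X : measurableType d}
  (mu : {measure set X -> \bar R}) (Q : {measure set X -> \bar R}) (q : X -> R).
Hypothesis mq : measurable_fun setT q.
Hypothesis q0 : forall x, 0 <= q x.
Hypothesis Qq : forall A, measurable A -> Q A = density_law mu q A.

(** [mu] may fail to be sigma-finite, so the identity is carried from indicators to simple functions
    to monotone limits. *)
Lemma ge0_integral_density (f : X -> \bar R) : measurable_fun setT f ->
  (forall x, 0 <= f x)%E -> (\int[Q]_x f x = \int[mu]_x (f x * (q x)%:E))%E.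
Proof.
move=> mf f0; pose h := nnsfun_approx measurableT mf.
have qe0 x : (0 <= (q x)%:E)%E by rewrite lee_fin.
have mqe : measurable_fun setT (fun x => (q x)%:E) by exact/measurable_EFinP.
have mh n : measurable_fun setT (EFin \o h n) by exact/measurable_EFinP.
have -> : (\int[Q]_x f x = lim (\int[Q]_x (EFin \o h n) x @[n --> \oo]))%E.
  have fE x : setT x -> f x = lim ((EFin \o h n) x @[n --> \oo]).
    by move=> _; apply/esym/cvg_lim => //; exact: cvg_nnsfun_approx.
  under eq_integral => x /[!inE] /fE -> //.
  apply: monotone_convergence => //.
  - by move=> n x _ //=; rewrite lee_fin.
  - by move=> x _ a b ab; rewrite lee_fin; exact/lefP/nd_nnsfun_approx.
have -> : (\int[mu]_x (f x * (q x)%:E) =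
    lim (\int[mu]_x ((EFin \o h n) x * (q x)%:E) @[n --> \oo]))%E.
  have fg x : setT x -> (f x * (q x)%:E = lim (((EFin \o h n) x * (q x)%:E) @[n --> \oo]))%E.
    move=> _; apply/esym/cvg_lim => //; apply: cvgeZr => //.
    exact: cvg_nnsfun_approx.
  under eq_integral => x /[!inE] /fg -> //.
  apply: monotone_convergence => [//| | |].
  - by move=> n; exact: emeasurable_funM.
  - by move=> n x _ /=; rewrite mule_ge0 ?lee_fin.
  - by move=> x _ a b ab/=; rewrite lee_wpmul2r ?lee_fin//; exact/lefP/nd_nnsfun_approx.
congr (lim _); congr (_ @ \oo); apply/funext => n.
transitivity (\int[Q]_x
   (\sum_(y \in range (h n)) (y * \1_(h n @^-1` [set y]) x)%:E))%E.
  by apply: eq_integral => t _; rewrite /= fimfunE -fsumEFin.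
have indich r : measurable_fun setT (fun x => (r * \1_(h n @^-1` [set r]) x)%:E).
  by apply: (measurable_comp measurableT) => //; exact: measurable_funM.
rewrite ge0_integral_fsum//; last by move=> m y Ey; exact: nnfun_muleindic_ge0.
transitivity (\int[mu]_x (\sum_(y \in range (h n))
    (y * \1_(h n @^-1` [set y]) x)%:E * (q x)%:E))%E; last first.
  apply: eq_integral => x _ /=.
  rewrite -ge0_mule_fsuml => [|y]; last exact: nnfun_muleindic_ge0.
  by rewrite fsumEFin // -(fimfunE _ x).
rewrite ge0_integral_fsum//; last 2 first.
  - by move=> y; apply: emeasurable_funM.
  - by move=> m y Ey; rewrite mule_ge0// nnfun_muleindic_ge0.
apply: eq_fsbigr => r rhn.
have r0 : 0 <= r by move: rhn; rewrite inE => -[t _ <-].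
under eq_integral do rewrite EFinM.
under [RHS]eq_integral do rewrite EFinM -muleA.
have mA : measurable (h n @^-1` [set r]) by exact: measurable_funPTI.
rewrite ge0_integralZl//; last by apply/measurable_EFinP; exact: measurable_indic.
rewrite ge0_integralZl//; last 2 first.
- by apply: emeasurable_funM => //; apply/measurable_EFinP; exact: measurable_indic.
- by move=> t _; rewrite mule_ge0 ?lee_fin.
congr (_ * _)%E.
rewrite integral_indic// setIT Qq// /density_law integral_mkcond.
by apply: eq_integral => x _; rewrite epatch_indic muleC.
Qed.

Lemma integral_density (f : X -> R) : Q.-integrable setT (EFin \o f) ->
  (\int[mu]_x (f x * q x)%:E = \int[Q]_x (f x)%:E)%E.
Proof.
move=> fi; have mf : measurable_fun setT f.
  by apply/measurable_EFinP; exact: measurable_int fi.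
rewrite integralE [RHS]integralE.
congr (_ - _)%E; rewrite ge0_integral_density//.
- apply: eq_integral => x _; rewrite !funeposE.
  by rewrite /= -!EFin_max -EFinM maxr_pMl// mul0r.
- exact: measurable_funepos (measurable_int _ fi).
- apply: eq_integral => x _; rewrite !funenegE -!EFinN.
  by rewrite /= -!EFin_max -EFinM maxr_pMl// mul0r mulNr.
- exact: measurable_funeneg (measurable_int _ fi).
Qed.

Lemma density_null_set : Q [set x | q x = 0] = 0%E.
Proof.
rewrite Qq; last by have := mq measurableT (measurable_set1 (0 : R)); rewrite setTI.
rewrite /density_law; apply: integral0_eq => x /= ->; by [].
Qed.

End density.

(** * The estimator *)

(** The estimator uses densities, the analysis their ratios to the unknown truth [c]; the values of
    [c] at the sample points cancel between numerator and evidence. *)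
Lemma bayes_predictive_scale {R : realType} {X : Type} {K : finType} (w : K -> R)
    (q g : K -> X -> R) (c : X -> R) (n m t : nat) (x : n.-tuple X) y :
  (forall k y, c y != 0 -> q k y = c y * g k y) ->
  (forall i, c (tnth x i) != 0) -> c y != 0 ->
  bayes_predictive w q m t x y = c y * bayes_predictive w g m t x y.
Proof.
move=> qg cx cy.
pose C := \prod_(i < n | (m <= i < t)%N) c (tnth x i).
have C0 : C != 0 by apply/prodf_neq0 => i _.
have pE k : \prod_(i < n | (m <= i < t)%N) q k (tnth x i) =
    C * \prod_(i < n | (m <= i < t)%N) g k (tnth x i).
  by rewrite -big_split/=; apply: eq_bigr => i _; rewrite qg.
rewrite /bayes_predictive /bayes_evidence.
have -> : \sum_k w k * \prod_(i < n | (m <= i < t)%N) q k (tnth x i) * q k y =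
    C * (c y * \sum_k w k * \prod_(i < n | (m <= i < t)%N) g k (tnth x i) * g k y).
  rewrite !mulr_sumr; apply: eq_bigr => k _; rewrite pE qg//; ring.
have -> : \sum_k w k * \prod_(i < n | (m <= i < t)%N) q k (tnth x i) =
    C * \sum_k w k * \prod_(i < n | (m <= i < t)%N) g k (tnth x i).
  by rewrite !mulr_sumr; apply: eq_bigr => k _; rewrite pE; ring.
by rewrite invfM mulrACA mulfV// mul1r mulrA.
Qed.

(** Each value of [S] is charged only its own probability, and these add up to 1: a data-dependent
    choice costs nothing. *)
Lemma integral_select_le {R : realType} {d} {Omega : measurableType d}
    (P : probability Omega R) {I : finType} (S : Omega -> I) (Y : I -> Omega -> R) :
  (forall i, measurable [set w | S w = i]) ->
  (forall i, measurable_fun setT (Y i)) -> (forall i w, 0 <= Y i w) ->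
  (forall i, \int[P]_w (\1_[set w | S w = i] w * Y i w)%:E <=
             \int[P]_w (\1_[set w | S w = i] w)%:E)%E ->
  measurable_fun setT (fun w => Y (S w) w) /\
  (\int[P]_w (Y (S w) w)%:E <= 1%:E)%E.
Proof.
move=> mS mY Y0 HY.
have E w : Y (S w) w = \sum_i \1_[set w | S w = i] w * Y i w.
  rewrite (bigD1 (S w))//= indicE mem_set// mul1r big1 ?addr0// => i iS.
  by rewrite indicE memNset ?mul0r//= => e; rewrite e eqxx in iS.
have m1 i : measurable_fun setT (fun w => \1_[set w | S w = i] w * Y i w).
  by apply: measurable_funM => //; exact: measurable_indic.
have mi i : measurable_fun setT (fun w => (\1_[set w | S w = i] w : R)%:E).
  by apply/measurable_EFinP; exact: measurable_indic.
split; first by under eq_fun do rewrite E; exact: measurable_sum.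
under eq_integral do rewrite E -sumEFin.
rewrite ge0_integral_sum//; last 2 first.
- by move=> i; exact/measurable_EFinP.
- by move=> i w _; rewrite lee_fin mulr_ge0.
apply: (@le_trans _ _ (\sum_i \int[P]_w (\1_[set w | S w = i] w)%:E)%E).
  by apply: lee_sum => i _; exact: HY.
rewrite -ge0_integral_sum//.
have S1 w : (\sum_i (\1_[set w | S w = i] w : R)%:E = 1%:E)%E.
  rewrite sumEFin (bigD1 (S w))//= indicE mem_set// big1 ?addr0// => i iS.
  by rewrite indicE memNset//= => e; rewrite e eqxx in iS.
rewrite -(integral_probability_cst P 1) le_eqVlt; apply/orP; left; apply/eqP.
by apply: eq_integral => w _; exact: S1.
Qed.

Section estimator.
Context {R : realType} {d} {X : measurableType d} (mu : {measure set X -> \bar R})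
  {M : nat} (n : nat) (delta : R) (p : 'I_M -> X -> R).
Hypothesis hp : forall j, is_density mu (p j).
Hypothesis M2 : (2 <= M)%N.
Hypothesis n2 : (2 <= n)%N.

(** Rounding up makes the first half at least as large as the second, which still has at least
    [n / 3] points for [n >= 2]. *)
Definition first_half : nat := n - n./2.
Definition mesh : nat := n * M.
Definition shift : R := mesh%:R^-1.
(** The Markov level of each of four failure events, which get probability [delta / 4] each. *)
Definition fail_ratio : R := 4 / delta.
Definition lik_bound : R := fail_ratio ^+ 2 * 6 ^+ M * expR 1.

(** The penalty is that of a Poisson likelihood: it makes unnormalised [u] comparable, so the
    lattice needs no simplex constraint. *)
Definition likelihood (u : 'I_M -> R) (x : n.-tuple X) : R :=
  \prod_(i < n | (i < first_half)%N) mixture p u (tnth x i) * expR (- (first_half%:R * mass u)).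

Local Notation I := (lattice (M:=M) (3 * mesh)).

Definition grid (k : I) : 'I_M -> R := lattice_point k.

(** [lik_bound] controls fourth roots, hence its fourth power; [expR 1] is the fourth power of the
    loss [expR (1 / 4)] from rounding the truth. The cap on the mass keeps the normalisation of net
    densities bounded. *)
Definition likely (k : I) (x : n.-tuple X) : bool :=
  (mass (grid k) <= 2) &&
  [forall l : I, (mass (grid l) <= 2) ==>
    (likelihood (grid l) x <= lik_bound ^+ 4 * expR 1 * likelihood (grid k) x)].

Definition likely_set (x : n.-tuple X) : {set I} := [set k | likely k x]%SET.

Definition is_net (T : {set I}) (y : pattern M -> 'I_M -> R) : Prop :=
  [/\ forall k, in_hull grid T (y k),
      forall i, i \in T -> exists2 k, (2 ^+ (3 * M + 2))^-1 <= pattern_weight R k &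
           forall j, grid i j <= 4 * (y k j + shift) &
      forall i k j, i \in T -> grid i j <= (12 * M%:R + 2) * (y k j + shift)].

(** The default keeps [net_density] a density even when [T] has no net, so that the estimator is a
    density on every sample. *)
Definition net (T : {set I}) : pattern M -> 'I_M -> R :=
  xget (fun _ _ => 1) [set y | is_net T y].

Definition net_point T k : 'I_M -> R := fun j => net T k j + shift.

Definition net_density (T : {set I}) (k : pattern M) (y : X) : R :=
  mixture p (net_point T k) y / mass (net_point T k).

Definition prior (k : pattern M) : R :=
  pattern_weight R k / \sum_(l : pattern M) pattern_weight R l.

Definition j0 : 'I_M := Ordinal (ltnW M2).

(* The first branch needs some [p j] to be positive at each observation: otherwise
   the evidence vanishes and its inverse is junk. *)
Definition estimator (x : n.-tuple X) : X -> R :=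
  if [forall i : 'I_n, mixture p (fun=> 1) (tnth x i) != 0]
  then bayes_average prior (net_density (likely_set x)) first_half x
  else p j0.

Let M0 : (0 < M)%N. Proof. exact: ltnW. Qed.
Let mesh0 : (0 < mesh)%N. Proof. by rewrite muln_gt0 M0 (ltnW n2). Qed.
Lemma shift_gt0 : 0 < shift. Proof. by rewrite invr_gt0 ltr0n. Qed.

Let p0 j x : 0 <= p j x. Proof. by have [_ + _] := hp j. Qed.
Let mp j : measurable_fun setT (p j). Proof. by have [] := hp j. Qed.
Let p1 j : (\int[mu]_x (p j x)%:E)%E = 1%E. Proof. by have [] := hp j. Qed.

Lemma first_half_lt : (first_half < n)%N.
Proof. by clear -n2; rewrite /first_half; lia. Qed.

Lemma net_is_net (T : {set I}) : (exists i, i \in T) -> is_net T (net T).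
Proof.
move=> Tne; rewrite /net; case: xgetP => [y _ //|H].
have [y Hy] := @one_sided_net R M I grid T shift shift_gt0
  (fun i j => ltac:(by rewrite lattice_point_ge0 lattice_point_le1)) M0 Tne.
by have := H y Hy.
Qed.

Lemma net_ge0 T k j : 0 <= net T k j.
Proof.
rewrite /net; case: xgetP => [y _ [yT _ _]|_]; last exact: ler01.
have /andP[//] := @in_hull01 R M I grid T
  (fun i j => ltac:(by rewrite lattice_point_ge0 lattice_point_le1)) (y k) j (yT k).
Qed.

Lemma net_point_gt0 T k j : 0 < net_point T k j.
Proof. by rewrite /net_point ltr_wpDl ?shift_gt0 ?net_ge0. Qed.

Lemma mass_net_point_gt0 T k : 0 < mass (net_point T k).
Proof.
rewrite /mass (bigD1 j0)//= ltr_pwDl ?net_point_gt0//.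
by apply: sumr_ge0 => j _; exact/ltW/net_point_gt0.
Qed.

Lemma net_density_ge0 T k y : 0 <= net_density T k y.
Proof.
rewrite divr_ge0 ?(ltW (mass_net_point_gt0 _ _))// mixture_ge0// => j.
exact/ltW/net_point_gt0.
Qed.

Lemma measurable_net_density T k : measurable_fun setT (net_density T k).
Proof. by apply: measurable_funM => //; apply: measurable_sum => j; exact: measurable_funM. Qed.

Lemma integral_lincomb {J : finType} (c : J -> R) (q : J -> X -> R) :
  (forall j, 0 <= c j) -> (forall j, measurable_fun setT (q j)) ->
  (forall j x, 0 <= q j x) -> (forall j, \int[mu]_x (q j x)%:E = 1)%E ->
  (\int[mu]_x (\sum_j c j * q j x)%:E = (\sum_j c j)%:E)%E.
Proof.
move=> c0 mq q0 q1.
under eq_integral do rewrite -sumEFin.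
rewrite ge0_integral_sum//; last 2 first.
- by move=> j; apply/measurable_EFinP; exact: measurable_funM.
- by move=> j x _; rewrite lee_fin mulr_ge0.
rewrite -sumEFin; apply: eq_bigr => j _.
under eq_integral do rewrite EFinM.
rewrite ge0_integralZl//; last 3 first.
- exact/measurable_EFinP.
- by move=> x _; rewrite lee_fin.
- by rewrite lee_fin.
by rewrite q1 mule1.
Qed.

Lemma integral_net_density T k : (\int[mu]_y (net_density T k y)%:E = 1)%E.
Proof.
have m0 := mass_net_point_gt0 T k.
have E y : net_density T k y = \sum_j (net_point T k j / mass (net_point T k)) * p j y.
  by rewrite /net_density mulr_suml; apply: eq_bigr => j _; rewrite mulrAC.
under eq_integral do rewrite E.
rewrite integral_lincomb//; last first.
  by move=> j; rewrite divr_ge0 ?ltW ?net_point_gt0.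
by rewrite -mulr_suml mulfV// gt_eqF.
Qed.

Lemma sum_pattern_weight_gt0 : 0 < \sum_l pattern_weight R (l : pattern M).
Proof.
rewrite (bigD1 [ffun=> ord0])//= ltr_pwDl ?pattern_weight_gt0//.
by apply: sumr_ge0 => k _; exact/ltW/pattern_weight_gt0.
Qed.

Lemma prior_gt0 k : 0 < prior k.
Proof. by rewrite divr_gt0 ?pattern_weight_gt0 ?sum_pattern_weight_gt0. Qed.

Lemma sum_prior : \sum_k prior k = 1.
Proof. by rewrite -mulr_suml mulfV// gt_eqF ?sum_pattern_weight_gt0. Qed.

Lemma le_prior k : pattern_weight R k <= prior k.
Proof.
rewrite ler_pdivlMr ?sum_pattern_weight_gt0//.
by rewrite ler_piMr ?(ltW (pattern_weight_gt0 _ _))// sum_pattern_weight_le1.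
Qed.

Lemma estimator_is_density x : is_density mu (estimator x).
Proof.
rewrite /estimator; case: ifP => [/forallP xpos|_]; last exact: hp.
set T := likely_set x.
have qx k i : 0 < net_density T k (tnth x i).
  rewrite divr_gt0 ?mass_net_point_gt0// lt_def mixture_ge0 ?andbT//; last first.
    by move=> j; exact/ltW/net_point_gt0.
  apply: contra (xpos i) => /eqP /psumr_eq0P H.
  apply/eqP; apply: big1 => j _; rewrite mul1r.
  have /eqP := H (fun j _ => mulr_ge0 (ltW (net_point_gt0 T k j)) (p0 j (tnth x i))) j isT.
  by rewrite mulf_eq0 gt_eqF ?net_point_gt0//= => /eqP.
have ev0 t : 0 < bayes_evidence prior (net_density T) first_half t x.
  by apply: bayes_evidence_gt0 => //; [exact: prior_gt0|exact: sum_prior].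
pose c t k := prior k * \prod_(i < n | (first_half <= i < t)%N) net_density T k (tnth x i) /
  bayes_evidence prior (net_density T) first_half t x.
have c0 t k : 0 <= c t k.
  rewrite divr_ge0 ?(ltW (ev0 t))// mulr_ge0 ?(ltW (prior_gt0 k))//.
  by rewrite prodr_ge0// => i _; exact: ltW.
have pE t y : bayes_predictive prior (net_density T) first_half t x y =
    \sum_k c t k * net_density T k y.
  by rewrite /bayes_predictive mulr_suml; apply: eq_bigr => k _; rewrite /c mulrAC.
pose D t y := bayes_predictive prior (net_density T) first_half t x y.
have mD t : measurable_fun setT (D t).
  rewrite /D; under eq_fun do rewrite pE.
  by apply: measurable_sum => k; apply: measurable_funM => //; exact: measurable_net_density.
have D0 t y : 0 <= D t y.
  by rewrite /D pE sumr_ge0// => k _; rewrite mulr_ge0 ?net_density_ge0.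
have D1 t : (\int[mu]_y (D t y)%:E = 1)%E.
  rewrite /D; under eq_integral do rewrite pE.
  rewrite integral_lincomb//.
  - rewrite /c -mulr_suml -/(bayes_evidence prior (net_density T) first_half t x).
    by rewrite mulfV ?gt_eqF.
  - exact: measurable_net_density.
  - exact: net_density_ge0.
  - exact: integral_net_density.
pose N : R := (n - first_half)%:R.
have N0 : 0 < N by rewrite ltr0n subn_gt0 first_half_lt.
pose b (t : 'I_n) := if (first_half <= t)%N then N^-1 else 0.
have aE y : bayes_average prior (net_density T) first_half x y = \sum_(t < n) b t * D t y.
  rewrite /bayes_average big_mkcond/= mulr_suml; apply: eq_bigr => t _.
  by rewrite /b; case: ifP => _; rewrite ?mul0r// mulrC.
have b0 t : 0 <= b t by rewrite /b; case: ifP => // _; rewrite invr_ge0 ltW.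
split.
- rewrite (_ : bayes_average _ _ _ _ = fun y => \sum_(t < n) b t * D t y).
    by apply: measurable_sum => t; apply: measurable_funM.
  exact/funext.
- by move=> y; rewrite aE sumr_ge0// => t _; rewrite mulr_ge0.
- under eq_integral do rewrite aE.
  rewrite integral_lincomb//; congr EFin.
  rewrite /b -big_mkcond sumr_const card_ge ?(ltnW first_half_lt)//.
  by rewrite -mulr_natl mulfV// gt_eqF.
Qed.

End estimator.

(** * Risk of the estimator *)

(** Here [s], [r], [b], [lr], [l] are [ln (4 / delta)], [M], [ln B], [ln M], [ln 6]. The left side
    is at most [50684 * r + 36630 * lr * s]. *)
Lemma rate_constant {R : realFieldType} (s r b lr l : R) : 0 <= s -> 2 <= r ->
  s * b <= s * (7 * lr) -> s * (1 / 2) <= s * lr -> r * l <= r * 5 ->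
  9 * (s * (12 + 6 * b) + ((3 * r + 2) + 2 * s +
    5 * (200 * (2 * s + r * l + 1) + 50 + 1))) <=
  (870 * 10 ^+ 3 + 30) * r + 45 * 10 ^+ 3 * lr * s.
Proof.
by move=> *; lra.
Qed.

Lemma density_law_dominates {R : realType} {d} {X : measurableType d}
    (mu : {measure set X -> \bar R}) (p q : X -> R) (c : R) :
  measurable_fun setT p -> measurable_fun setT q ->
  (forall x, 0 <= p x) -> (forall x, 0 <= q x) -> 0 <= c ->
  (forall x, p x <= c * q x) -> density_law mu p `<< density_law mu q.
Proof.
move=> mp mq p0 q0 c0 pq N qN A mA AN; have qA := qN A mA AN.
apply/eqP; rewrite eq_le integral_ge0 ?andbT; last by move=> x _; rewrite lee_fin.
rewrite -(mule0 c%:E) -qA /density_law -ge0_integralZl//; last 2 first.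
- by apply/measurable_EFinP; apply: measurable_funTS.
- by move=> x _; rewrite lee_fin.
apply: ge0_le_integral => //.
- by move=> x _; rewrite lee_fin.
- by apply/measurable_EFinP; apply: measurable_funTS.
- by apply/measurable_EFinP; apply: measurable_funTS; exact: measurable_funM.
- by move=> x _; rewrite -EFinM lee_fin.
Qed.

Section analysis.
Context {R : realType} {d} {X : measurableType d} (mu : {measure set X -> \bar R})
  {M : nat} (n : nat) (delta : R) (p : 'I_M -> X -> R).
Hypothesis hp : forall j, is_density mu (p j).
Hypothesis M2 : (2 <= M)%N.
Hypothesis n2 : (2 <= n)%N.
Hypothesis delta0 : 0 < delta.
Hypothesis delta1 : delta < 1.
Variable theta : 'I_M -> R.
Hypothesis theta0 : forall j, 0 <= theta j.
Hypothesis theta1 : \sum_j theta j = 1.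
Context {d'} {Omega : measurableType d'} (P : probability Omega R)
  (Xs : 'I_n -> {RV P >-> X}).

Let pstar : X -> R := mixture p theta.
Hypothesis iid : iid_with_density mu Xs pstar.

Local Notation half1 := (first_half n).
Local Notation mesh := (mesh (M := M) n).
Local Notation I := (lattice (M:=M) (3 * mesh)).
Local Notation grid := (@grid R M n).

Let p0 j x : 0 <= p j x. Proof. by have [_ + _] := hp j. Qed.
Let mp j : measurable_fun setT (p j). Proof. by have [] := hp j. Qed.
Let p1 j : (\int[mu]_x (p j x)%:E)%E = 1%E. Proof. by have [] := hp j. Qed.

Let i0 : 'I_n := Ordinal (ltnW n2).
Let Q : probability X R := distribution P (Xs i0).

Let lawQ i A : measurable A -> P (Xs i @^-1` A) = Q A.
Proof.
move=> mA; have [law _] := iid.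
exact: etrans (law i A mA) (esym (law i0 A mA)).
Qed.

Let indep (A : 'I_n -> set X) : (forall i, measurable (A i)) ->
  P (\bigcap_i (Xs i @^-1` A i)) = (\prod_(i < n) P (Xs i @^-1` A i))%E.
Proof. by have [_ ind] := iid; exact: ind. Qed.

Let mpstar : measurable_fun setT pstar.
Proof. by apply: measurable_sum => j; exact: measurable_funM. Qed.

Let pstar0 x : 0 <= pstar x.
Proof. exact: mixture_ge0. Qed.

Let Qpstar A : measurable A -> Q A = density_law mu pstar A.
Proof. by have [law _] := iid; exact: law. Qed.

(* The convention 1 on the null set where [pstar] vanishes makes the ratios of
   the truth equal to 1 everywhere. *)
Let f (j : 'I_M) (x : X) : R := if pstar x == 0 then 1 else p j x / pstar x.

Let mf j : measurable_fun setT (f j).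
Proof.
apply: measurable_fun_ifT.
- by apply: measurable_fun_eqr => //; exact: measurable_cst.
- exact: measurable_cst.
- by apply: measurable_funM => //; exact: measurable_fun_inv_ge0.
Qed.

Let f0 j x : 0 <= f j x.
Proof. by rewrite /f; case: ifP => // _; rewrite divr_ge0. Qed.

Let f1 j : (\int[Q]_x (f j x)%:E <= 1)%E.
Proof.
rewrite (ge0_integral_density mpstar pstar0 Qpstar); last 2 first.
- exact/measurable_EFinP.
- by move=> x; rewrite lee_fin.
rewrite -(p1 j); apply: ge0_le_integral => //.
- by move=> x _; rewrite mule_ge0 ?lee_fin.
- by apply: emeasurable_funM; exact/measurable_EFinP.
- exact/measurable_EFinP.
- move=> x _; rewrite -EFinM lee_fin /f; case: ifPn => [/eqP ->|pn0].
    by rewrite mulr0.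
  by rewrite divfK.
Qed.

Let mixture_f u x : pstar x != 0 -> mixture p u x = pstar x * mixture f u x.
Proof.
move=> px; rewrite /mixture mulr_sumr; apply: eq_bigr => j _.
by rewrite /f (negbTE px) mulrCA [pstar x * _]mulrC divfK.
Qed.

Let mixture_f_theta x : mixture f theta x = 1.
Proof.
have [px|px] := eqVneq (pstar x) 0.
  by rewrite /mixture -[RHS]theta1; apply: eq_bigr => j _; rewrite /f px eqxx mulr1.
by apply: (mulfI px); rewrite -mixture_f// mulr1.
Qed.

Let M0 : (0 < M)%N. Proof. exact: ltnW. Qed.
Let n0 : (0 < n)%N. Proof. exact: ltnW. Qed.
Let mesh0 : (0 < mesh)%N. Proof. by rewrite muln_gt0 M0 n0. Qed.
Let meshR : 0 < mesh%:R :> R. Proof. by rewrite ltr0n. Qed.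
Let M_mesh : n%:R * (M%:R / mesh%:R) = 1 :> R.
Proof. by rewrite mulrA -natrM mulfV// gt_eqF. Qed.

Let k0_spec : exists k : lattice (M:=M) mesh,
  (forall j, theta j <= lattice_point k j <= theta j + mesh%:R^-1).
Proof.
apply: lattice_round_up => // j; rewrite theta0/= -theta1 (bigD1 j)//=.
by rewrite lerDl sumr_ge0.
Qed.

Let k0 := sval (cid k0_spec).
Let u0 : 'I_M -> R := lattice_point k0.

Let k0_ge1 x : 1 <= mixture f u0 x.
Proof.
rewrite -(mixture_f_theta x); apply: le_mixture => // j.
by have /(_ j)/andP[] := svalP (cid k0_spec).
Qed.

Let k0_mass : mass u0 <= 1 + M%:R / mesh%:R.
Proof.
apply: (@le_trans _ _ (\sum_(j < M) (theta j + mesh%:R^-1))).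
  by apply: ler_sum => j _; have /(_ j)/andP[] := svalP (cid k0_spec).
by rewrite big_split/= theta1 sumr_const card_ord -[X in _ + X]mulr_natl.
Qed.

Let fine_k0 : I := [ffun j => inord (3 * k0 j)].

Let grid_k0 : grid fine_k0 = u0.
Proof.
apply/funext => j; rewrite /grid /u0 /lattice_point ffunE inordK; last first.
  by have := ltn_ord (k0 j); lia.
by rewrite !natrM; field; rewrite !pnatr_eq0 -!lt0n M0 n0.
Qed.

(** * Concentration of the likely set *)

Let first : pred 'I_n := fun i => (i < half1)%N.

Let card_first : #|first| = half1.
Proof.
have h := first_half_lt n2; have := cardC first.
rewrite (@eq_card _ (predC first) [pred t : 'I_n | (half1 <= t)%N]); last first.
  by move=> t; rewrite !inE -leqNgt.
rewrite (card_ge (ltnW h)) card_ord => e; apply: (@addIn (n - half1)%N).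
by rewrite subnKC ?(ltnW h).
Qed.

Let m : R := half1%:R.
Let m0 : 0 <= m. Proof. by rewrite ler0n. Qed.

Local Notation h := (hellinger Q f).

Let m_mesh : #|first|%:R * M%:R <= mesh%:R :> R.
Proof.
rewrite card_first -natrM ler_nat leq_mul2r; apply/orP; right.
exact: ltnW (first_half_lt n2).
Qed.

Let mM_mesh : m * (M%:R / mesh%:R) <= 1.
Proof.
apply: (@le_trans _ _ (n%:R * (M%:R / mesh%:R))); last by rewrite M_mesh.
by rewrite ler_wpM2r ?divr_ge0// ler_nat (ltnW (first_half_lt n2)).
Qed.

Local Notation lik4 := (lik_ratio4 Xs f first).
Local Notation A := (fail_ratio delta).
Local Notation D := (lik_bound (M := M) delta).
Let L : R := ln A.
Let A4 : 4 < A. Proof. rewrite /fail_ratio ltr_pdivlMr//. have := delta1. lra. Qed.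
Let A0 : 0 < A. Proof. by apply: lt_trans A4. Qed.
Let L0 : 0 <= L. Proof. by apply: ln_ge0; apply: le_trans (ltW A4); rewrite ler1n. Qed.
Let D0 : 0 < D.
Proof. by apply: mulr_gt0; [apply: mulr_gt0; exact: exprn_gt0|exact: expR_gt0]. Qed.
Let lnD : ln D = 2 * L + M%:R * ln 6 + 1.
Proof.
have a2 : 0 < A ^+ 2 by exact: exprn_gt0.
have a6 : 0 < 6 ^+ M :> R by exact: exprn_gt0.
have a26 : 0 < A ^+ 2 * 6 ^+ M by exact: mulr_gt0.
rewrite /lik_bound lnM ?posrE ?expR_gt0// (lnM a2 a6) !lnXn//.
by rewrite expRK !mulr_natl.
Qed.

(** The unknown truth contributes a factor independent of [u], so comparing observable likelihoods
    amounts to comparing ratios. *)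
Let likelihoodE u w : (forall j, 0 <= u j) -> (forall i, pstar (Xs i w) != 0) ->
  likelihood p u (sample Xs w) =
  \prod_(i < n | first i) pstar (Xs i w) * expR (- m) * lik4 u w ^+ 4.
Proof.
move=> u_ge0 pw; rewrite /likelihood /lik_ratio4 exprMn -expRM_natl.
rewrite [RHS]mulrACA -prodrXl -big_split/= -expRD card_first; congr (_ * expR _).
  apply: eq_big => // i _; rewrite tnth_sample mixture_f//; congr (_ * _).
  by rewrite -[4%N]/(2 * 2)%N exprM !sqr_sqrtr ?sqrtr_ge0// mixture_ge0.
by rewrite -/m; lra.
Qed.

(** This is [100 * (2 * ln D + 1 / 2)]: against the rate [1 / 100], a likely point loses twice a
    factor [D] and twice the rounding factor [expR (1 / 4)]. *)
Let eps : R := 200 * ln D + 50.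

Definition good (T : {set I}) : Prop :=
  fine_k0 \in T /\ forall k, k \in T -> mass (grid k) <= 2 /\ m * h (grid k) <= eps.

Let grid_ge0 k j : 0 <= grid k j. Proof. exact: lattice_point_ge0. Qed.

Local Notation W := (lattice_weight Q f first mesh).

Let good_likely_set w : (forall i, pstar (Xs i w) != 0) ->
  lik_sum Xs Q f first mesh w <= A * (expR (1 / 4) * 6 ^+ M * W) ->
  inv_lik_sum Xs Q f first k0 w <= A * (expR (1 / 3) * W) ->
  good (likely_set delta p (sample Xs w)).
Proof.
move=> pw Psi_le U_le.
have bound (k : I) : lik4 (grid k) w * expR (m * h (grid k) / 100) <= D.
  have := @lik_ratio4_bound _ _ _ _ _ P n Xs Q M f mf f0 f1 first mesh k0 mesh0
    m_mesh k0_ge1 k0_mass A w k A0 Psi_le U_le.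
  by rewrite card_first.
have lik4_0 u : 0 <= lik4 u w by exact: lik_ratio4_ge0.
have h0 k : 0 <= m * h (grid k) by rewrite mulr_ge0// hellinger_ge0.
pose C := \prod_(i < n | first i) pstar (Xs i w) * expR (- m).
have C0 : 0 < C.
  by rewrite mulr_gt0 ?expR_gt0// prodr_gt0// => i _; rewrite lt_def pw pstar0.
have likE k : likelihood p (grid k) (sample Xs w) = C * lik4 (grid k) w ^+ 4.
  by rewrite likelihoodE.
have lik4_D (k : I) : lik4 (grid k) w <= D.
  apply: le_trans (bound k); rewrite -[leLHS]mulr1 ler_wpM2l//.
  by rewrite -expR0 ler_expR divr_ge0.
have lik4_k0 : expR (- (1 / 4)) <= lik4 (grid fine_k0) w.
  rewrite grid_k0 /lik_ratio4 -[leLHS]mul1r ler_pM ?expR_ge0//.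
    apply: (@le_trans _ _ (\prod_(i < n | first i) 1)); first by rewrite big1.
    apply: ler_prod => i _; rewrite ler01/= -sqrtr1 ler_wsqrtr// -sqrtr1.
    exact: ler_wsqrtr (k0_ge1 _).
  rewrite ler_expR card_first.
  by have := ler_wpM2l m0 k0_mass; have := mM_mesh; rewrite -/m; lra.
have De0 : 0 <= D * expR (1 / 4) := mulr_ge0 (ltW D0) (expR_ge0 _).
have Dl0 k : 0 <= D * expR (1 / 4) * lik4 (grid k) w by exact: mulr_ge0.
have scale k l : lik4 (grid l) w <= D * expR (1 / 4) * lik4 (grid k) w ->
    likelihood p (grid l) (sample Xs w) <=
    D ^+ 4 * expR 1 * likelihood p (grid k) (sample Xs w).
  rewrite !likE => H.
  have -> : expR 1 = expR (1 / 4) ^+ 4 :> R by rewrite -expRM_natl; congr expR; field.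
  rewrite [leRHS]mulrCA -!exprMn ler_wpM2l ?(ltW C0)// ler_pXn2r ?nnegrE//.
split.
- rewrite inE /likely grid_k0.
  have -> : mass u0 <= 2.
    apply: (le_trans k0_mass); rewrite (_ : 2 = 1 + 1)// lerD2l.
    by rewrite ler_pdivrMr// mul1r ler_nat leq_pmull.
  apply/forallP => l; apply/implyP => _; rewrite -grid_k0; apply: scale.
  apply: (le_trans (lik4_D l)).
  rewrite -mulrA ler_peMr ?(ltW D0)//.
  by have := ler_wpM2l (expR_ge0 (1 / 4)) lik4_k0; rewrite expRxMexpNx_1.
move=> k; rewrite inE => /andP[k2 /forallP/(_ fine_k0)/implyP].
rewrite grid_k0; have mk0 : mass u0 <= 2.
  apply: (le_trans k0_mass); rewrite (_ : 2 = 1 + 1)// lerD2l.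
  by rewrite ler_pdivrMr// mul1r ler_nat leq_pmull.
move=> /(_ mk0); rewrite -grid_k0 !likE.
have -> : expR 1 = expR (1 / 4) ^+ 4 :> R by rewrite -expRM_natl; congr expR; field.
rewrite [leRHS]mulrCA -!exprMn ler_pM2l// ler_pXn2r ?nnegrE//.
move=> H; split=> //.
have H1 : expR (- (1 / 4)) <= D * expR (1 / 4) * lik4 (grid k) w by exact: le_trans H.
have H2 : expR (- (1 / 4)) * expR (m * h (grid k) / 100) <= D * expR (1 / 4) * D.
  apply: le_trans (ler_wpM2r (expR_ge0 _) H1) _.
  by rewrite -[leLHS]mulrA ler_wpM2l.
have : expR (- (1 / 4) + m * h (grid k) / 100) <= expR (ln D + 1 / 4 + ln D).
  by rewrite !expRD !lnK ?posrE.
by rewrite ler_expR /eps; lra.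
Qed.

(** * Density ratios of the net points *)

Local Notation net' := (net (R := R) (M := M) (n := n)).
Local Notation zpt := (net_point (R := R) (M := M) (n := n)).

Let gpred T (k : pattern M) (x : X) : R := mixture f (zpt T k) x / mass (zpt T k).
(** Domination by [12 * M + 2] and mass at most 3 require [3 * (12 * M + 2) <= B]; the power
    [64 = 2 ^ 6] gives [B <= M ^ 7]. *)
Let B : R := 64 * M%:R.
Let eta : R := (12 + 6 * ln B)^-1.

Let M2R : 2 <= M%:R :> R. Proof. by rewrite ler_nat. Qed.
Let B1 : 1 <= B. Proof. by rewrite /B; have := M2R; lra. Qed.
Let eta_B : eta * (12 + 6 * ln B) = 1.
Proof. by rewrite mulVf//; have := ln_ge0 B1; lra. Qed.

Let zpt0 T k j : 0 < zpt T k j. Proof. exact: net_point_gt0. Qed.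
Let zmass0 T k : 0 < mass (zpt T k). Proof. exact: mass_net_point_gt0. Qed.

Let mgpred T k : measurable_fun setT (gpred T k).
Proof. by apply: measurable_funM => //; exact: measurable_mixture. Qed.

Let mixtureZ a u x : mixture f (fun j => a * u j) x = a * mixture f u x.
Proof. by rewrite /mixture mulr_sumr; apply: eq_bigr => j _; rewrite mulrA. Qed.

Let gpred1 T k : (\int[Q]_x (gpred T k x)%:E <= 1)%E.
Proof.
have E x : gpred T k x = mixture f (fun j => (mass (zpt T k))^-1 * zpt T k j) x.
  by rewrite mixtureZ mulrC.
under eq_integral do rewrite E.
apply: le_trans (integral_mixture_le mf f0 f1 _) _.
  by move=> j; rewrite mulr_ge0 ?invr_ge0 ?ltW.
by rewrite /mass -mulr_sumr -/(mass _) mulVf// gt_eqF.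
Qed.

Let netP T : good T -> is_net T (net' T).
Proof. by move=> [kT _]; apply: net_is_net => //; exists fine_k0. Qed.

(** All three conditions are convex in the point, the last one because [h] is, so they pass from [T]
    to its hull. *)
Let good_net T k : good T ->
  [/\ forall j, 0 <= net' T k j, mass (net' T k) <= 2 & m * h (net' T k) <= eps].
Proof.
move=> gT; have [hull _ _] := netP gT; have [kT Tle] := gT.
apply: (hull k (fun u => [/\ forall j, 0 <= u j, mass u <= 2 & m * h u <= eps])).
- move=> s u v s01 [u_0 um uh] [v_0 vm vh].
  have /andP[s0 s1] := s01.
  split=> [j||].
  + by rewrite addr_ge0 ?mulr_ge0 ?subr_ge0.
  + by rewrite mass_lin; nra.
  + have hc := hellinger_conv mf f0 f1 s01 u_0 v_0.
    have := ler_wpM2l m0 hc; nra.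
- by move=> i iT; have [? ?] := Tle i iT; split=> // j; exact: grid_ge0.
Qed.

Let mass_zpt T k : mass (zpt T k) = mass (net' T k) + M%:R / mesh%:R.
Proof.
by rewrite /mass /net_point big_split/= sumr_const card_ord -[X in _ + X]mulr_natl.
Qed.

Let Mmesh1 : M%:R / mesh%:R <= 1 :> R.
Proof. by rewrite ler_pdivrMr// mul1r ler_nat leq_pmull. Qed.

Let gpredB T k x : good T -> B^-1 <= gpred T k x.
Proof.
move=> gT; have [_ nm _] := good_net k gT.
have [_ _ dom] := netP gT.
have dom_le : mixture f u0 x <= (12 * M%:R + 2) * mixture f (zpt T k) x.
  rewrite -mixtureZ; apply: le_mixture => // j; rewrite -grid_k0.
  by apply: dom; exact: (proj1 gT).
have Fz : 1 <= (12 * M%:R + 2) * mixture f (zpt T k) x.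
  exact: le_trans (k0_ge1 x) dom_le.
have zm : mass (zpt T k) <= 3.
  by rewrite mass_zpt; have := Mmesh1; lra.
rewrite /gpred ler_pdivlMr// -ler_pdivlMl ?invr_gt0 ?(lt_le_trans ltr01 B1)// invrK.
apply: (le_trans zm); rewrite /B.
have Fz0 : 0 < mixture f (zpt T k) x.
  rewrite -(pmulr_rgt0 _ (_ : 0 < 12 * M%:R + 2)); first exact: lt_le_trans Fz.
  by have := M2R; lra.
have := M2R; nra.
Qed.

(** The net point that dominates the rounded truth up to a factor 4. It depends on [T] only, hence
    is fixed before the second half is seen. *)
Let kap T : pattern M := xget [ffun=> ord0]
  [set k | (2 ^+ (3 * M + 2))^-1 <= pattern_weight R k /\
           forall j, u0 j <= 4 * zpt T k j].

Let kapP T : good T -> (2 ^+ (3 * M + 2))^-1 <= pattern_weight R (kap T) /\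
  forall j, u0 j <= 4 * zpt T (kap T) j.
Proof.
move=> gT; rewrite /kap; case: xgetP => [k _ //|H].
have [_ cov _] := netP gT.
have [k k1 k2] := cov _ (proj1 gT).
by case: (H k); split=> // j; rewrite -grid_k0; exact: k2.
Qed.

Let kap_quarter T x : good T -> 1 / 4 <= mixture f (zpt T (kap T)) x.
Proof.
move=> gT; have [_ u0z] := kapP gT.
have H : mixture f u0 x <= 4 * mixture f (zpt T (kap T)) x.
  by rewrite -mixtureZ; exact: le_mixture.
have := k0_ge1 x; lra.
Qed.

Let kap_hellinger T : good T -> m * h (zpt T (kap T)) <= eps + 1.
Proof.
move=> gT; have [n_0 _ nh] := good_net (kap T) gT.
have nz j : net' T (kap T) j <= zpt T (kap T) j.
  by rewrite /net_point lerDl ltW// shift_gt0.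
have := ler_wpM2l m0 (hellinger_mono mf f0 f1 n_0 nz).
by rewrite mass_zpt; have := mM_mesh; lra.
Qed.

(** * Prediction on the second half *)

Let second : pred 'I_n := fun i => (half1 <= i)%N.
Let N : R := (n - half1)%:R.

Let card_second : #|second| = (n - half1)%N.
Proof. exact: card_ge (ltnW (first_half_lt n2)). Qed.

Let N0 : 0 < N. Proof. by rewrite ltr0n subn_gt0 first_half_lt. Qed.

Let Nm : N <= m.
Proof. by rewrite ler_nat /first_half; clear; lia. Qed.

Let nN : n%:R <= 3 * N.
Proof. by rewrite -natrM ler_nat /first_half; clear -n2; lia. Qed.

Local Notation prior := (prior (R := R) (M := M)).
Let factor T (t : 'I_n) (x : n.-tuple X) (y : X) : R :=
  predictive_factor Q prior (gpred T) half1 eta t x y.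

(** Growth rate of the inverse square-root likelihood; its mass term later compensates the
    normalisation of the net density. *)
Let comp_rate T : R := 5 / 2 * h (zpt T (kap T)) - (mass (zpt T (kap T)) - 1) / 2.

Let comp T (y : X) : R :=
  (Num.sqrt (mixture f (zpt T (kap T)) y))^-1 * expR (- comp_rate T).

(** The value 1 on sets that are not good keeps the mean bound valid for every value of the likely
    set. *)
Let Y (G : {set I} -> 'I_n -> n.-tuple X -> X -> R) T (w : Omega) : R :=
  if `[< good T >] then \prod_(t < n | second t) G T t (sample Xs w) (Xs t w) else 1.

Local Notation sel := (fun w => likely_set (M := M) delta p (sample Xs w)).

Let measurable_likelihood u : measurable_fun setT (likelihood (n := n) p u).
Proof.
apply: measurable_funM => //.
under eq_fun do rewrite -big_filter; apply: measurable_prod => i _.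
have mpu : measurable_fun setT (mixture p u) by exact: measurable_mixture.
exact: measurableT_comp mpu (measurable_tnth i).
Qed.

Let measurable_likely (k : I) : measurable [set x : n.-tuple X | likely delta p k x].
Proof.
rewrite /likely; case: (mass (grid k) <= 2) => /=; last first.
  by rewrite (_ : [set _ | _] = set0)//; apply/seteqP; split.
rewrite (_ : [set _ | _] = \bigcap_(l in [set: I])
    (if mass (grid l) <= 2 then [set x : n.-tuple X | likelihood p (grid l) x <=
      D ^+ 4 * expR 1 * likelihood p (grid k) x] else setT)); last first.
  apply/seteqP; split=> [x /= /forallP H l _|x /= H].
    by have := H l; case: ifP.
  by apply/forallP => l; have := H l Logic.I; case: ifP.
apply: fin_bigcap_measurable => [|l _]; first exact: finite_finset.
case: ifP => // _; rewrite -[X in measurable X]setTI.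
by apply: measurable_fun_le => //; exact: measurable_funM.
Qed.

Let measurable_likely_set (T : {set I}) :
  measurable [set x : n.-tuple X | likely_set delta p x = T].
Proof.
rewrite (_ : [set _ | _] = \bigcap_(k in [set: I])
    (if k \in T then [set x : n.-tuple X | likely delta p k x]
     else ~` [set x : n.-tuple X | likely delta p k x])); last first.
  apply/seteqP; split=> [x /= <- k _|x /= H].
    by rewrite inE; case: ifP => //= /negbT/negP.
  apply/setP => k; rewrite inE; have := H k Logic.I.
  by case: ifP => //= _ /negP/negbTE.
apply: fin_bigcap_measurable => [|k _]; first exact: finite_finset.
by case: ifP => // _; exact: measurableC.
Qed.

Let likely_set_prefix (T : {set I}) :
  prefix_dependent half1 (\1_[set x : n.-tuple X | likely_set delta p x = T] : _ -> R).
Proof.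
move=> x y xy.
have H u : likelihood p u x = likelihood p u y.
  by congr (_ * _); apply: eq_bigr => i ih; rewrite xy.
suff e : likely_set delta p x = likely_set (M := M) delta p y.
  by rewrite !indicE; congr ((nat_of_bool _)%:R); apply/idP/idP; rewrite !inE/= e.
by apply/setP => k; rewrite !inE /likely; congr (_ && _); apply: eq_forallb => l; rewrite !H.
Qed.

Let select_le (G : {set I} -> 'I_n -> n.-tuple X -> X -> R) :
  (forall T t, good T -> measurable_fun setT (fun z : n.-tuple X * X => G T t z.1 z.2)) ->
  (forall T t x y, 0 <= G T t x y) ->
  (forall T (t : 'I_n) y, prefix_dependent t (G T t ^~ y)) ->
  (forall T t x, good T -> \int[Q]_y (G T t x y)%:E <= 1)%E ->
  measurable [set w | A < Y G (sel w) w] /\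
  (P [set w | (A < Y G (sel w) w)%R] <= (A^-1)%:E)%E.
Proof.
move=> mG G0 Gt G1.
have Y0 T w : 0 <= Y G T w.
  by rewrite /Y; case: ifP => // _; rewrite prodr_ge0.
have [mY IY] : measurable_fun setT (fun w => Y G (sel w) w) /\
    (\int[P]_w (Y G (sel w) w)%:E <= 1%:E)%E.
  apply: integral_select_le => //.
  - move=> T; rewrite -[X in measurable X]setTI.
    exact: (measurable_sample Xs measurableT (measurable_likely_set T)).
  - move=> T; rewrite /Y; case: asboolP => gT; last exact: measurable_cst.
    under eq_fun do rewrite -big_filter; apply: measurable_prod => t _.
    have mpair : measurable_fun setT (fun w => (sample Xs w, Xs t w)).
      by apply: measurable_fun_pair => //; exact: measurable_sample.
    exact: measurableT_comp (mG T t gT) mpair.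
  - move=> T; rewrite /Y; case: asboolP => gT; last first.
      by under eq_integral do rewrite mulr1.
    apply: (@integral_chain _ _ _ _ _ P n Xs Q lawQ indep half1
      (\1_[set x | likely_set delta p x = T]) (G T)) => //.
    + by move=> t; exact: mG.
    + by move=> t x; exact: G1.
split; first exact: measurable_set_lt.
by rewrite -[A^-1]mul1r; exact: markov_ge.
Qed.

Let prior0 k : 0 < prior k. Proof. exact: prior_gt0. Qed.
Let prior1 : \sum_k prior k = 1. Proof. exact: sum_prior. Qed.

Let bad3 : measurable [set w | A < Y factor (sel w) w] /\
  (P [set w | (A < Y factor (sel w) w)%R] <= (A^-1)%:E)%E.
Proof.
apply: select_le => [T t gT|T t x y|T t y|T t x gT].
- exact: (measurable_predictive_factor half1 prior0 prior1 (mgpred T) (gpred1 T) B1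
    (fun k y => gpredB k y gT) eta_B).
- exact: predictive_factor_ge0.
- exact: predictive_factor_prefix.
- exact: (integral_predictive_factor half1 prior0 prior1 (mgpred T) (gpred1 T) B1
    (fun k y => gpredB k y gT) eta_B).
Qed.

Let bad4 : measurable [set w | A < Y (fun T _ _ => comp T) (sel w) w] /\
  (P [set w | (A < Y (fun T _ _ => comp T) (sel w) w)%R] <= (A^-1)%:E)%E.
Proof.
have mF T : measurable_fun setT (mixture f (zpt T (kap T))) by exact: measurable_mixture.
have mS T : measurable_fun setT (fun y => (Num.sqrt (mixture f (zpt T (kap T)) y))^-1).
  apply: measurable_fun_inv_ge0; first exact: measurable_fun_sqrt.
  by move=> y; exact: sqrtr_ge0.
have mC T : measurable_fun setT (comp T) by exact: measurable_funM.
apply: select_le => [T t gT|T t x y|T t y|T t x gT] //.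
- exact: measurableT_comp (mC T) measurable_snd.
- by rewrite mulr_ge0 ?expR_ge0// invr_ge0 sqrtr_ge0.
rewrite /comp; under eq_integral do rewrite EFinM.
rewrite ge0_integralZr//; last exact/measurable_EFinP.
have z0 j : 0 <= zpt T (kap T) j by exact: ltW.
apply: le_trans (lee_wpmul2r _ (integral_inv_sqrt_le mf f0 f1 z0
  (fun y => kap_quarter y gT))) _; first by rewrite lee_fin expR_ge0.
rewrite -EFinM lee_fin -[leRHS](expRxMexpNx_1 (comp_rate T)) ler_wpM2r ?expR_ge0//.
by apply: le_trans (expR_ge1Dx _); rewrite /comp_rate; lra.
Qed.

(** The evidence is at least the contribution of the single net point [kap T]. Taking logarithms
    doubles [comp_rate], which gives the 5, and [ln a <= a - 1] removes the mass. [N <= m] transfers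
    the first-half bound on [m * h] to the second half. *)
Let ln_evidence_ge T w : good T -> Y (fun T _ _ => comp T) T w <= A ->
  - ln (bayes_evidence prior (gpred T) half1 n (sample Xs w)) <=
  (3 * M%:R + 2) + 2 * L + 5 * (eps + 1).
Proof.
move=> gT; rewrite /Y asboolT// => HA.
pose a := mass (zpt T (kap T)); have a0 : 0 < a := zmass0 _ _.
pose F t := mixture f (zpt T (kap T)) (Xs t w).
have F0 t : 0 < F t by apply: lt_le_trans (kap_quarter _ gT).
have second_cst (c : R) : \sum_(t < n | second t) c = N * c.
  by rewrite sumr_const card_second -[LHS]mulr_natl.
have compE t : comp T (Xs t w) = expR (- (ln (F t) / 2) - comp_rate T).
  rewrite expRD; congr (_ * _); rewrite expRN -/(F t); congr (_^-1).
  rewrite -{1}(lnK (F0 t)) (_ : ln (F t) = ln (F t) / 2 + ln (F t) / 2); last by field.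
  by rewrite expRD -expr2 sqrtr_sqr ger0_norm ?expR_ge0//; congr expR; field.
have sumF : - \sum_(t < n | second t) ln (F t) <= 2 * L + 2 * (N * comp_rate T).
  have : expR (\sum_(t < n | second t) (- (ln (F t) / 2) - comp_rate T)) <= expR L.
    rewrite expR_sum lnK//; apply: le_trans HA.
    by rewrite le_eqVlt; apply/orP; left; apply/eqP; apply: eq_bigr => t _; rewrite compE.
  rewrite ler_expR big_split/= second_cst sumrN -mulr_suml; lra.
have ev_ge : prior (kap T) * expR (\sum_(t < n | second t) (ln (F t) - ln a)) <=
    bayes_evidence prior (gpred T) half1 n (sample Xs w).
  rewrite /bayes_evidence (bigD1 (kap T))//= expR_sum.
  have -> : \prod_(t < n | second t) expR (ln (F t) - ln a) =
      \prod_(i < n | (half1 <= i < n)%N) gpred T (kap T) (tnth (sample Xs w) i).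
    apply: eq_big => [t|t _]; first by rewrite ltn_ord andbT.
    by rewrite tnth_sample expRD expRN (lnK (F0 t)) (lnK a0).
  rewrite lerDl sumr_ge0// => k _; rewrite mulr_ge0 ?(ltW (prior0 k))//.
  rewrite prodr_ge0// => i _; apply: le_trans (gpredB _ _ gT).
  by rewrite invr_ge0; apply: le_trans B1.
have pr_ge : expR (- (3 * M%:R + 2)) <= prior (kap T).
  apply: le_trans (@le_prior _ _ _); apply: le_trans (proj1 (kapP gT)).
  rewrite expRN lef_pV2 ?posrE ?expR_gt0 ?exprn_gt0//.
  have -> : 3 * M%:R + 2 = (3 * M + 2)%:R * 1 :> R by rewrite natrD natrM mulr1.
  rewrite expRM_natl; apply: lerXn2r; rewrite ?nnegrE ?expR_ge0//.
  by have := expR_ge1Dx (1 : R); lra.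
have ev_ge2 : expR (- (3 * M%:R + 2)) * expR (\sum_(t < n | second t) (ln (F t) - ln a)) <=
    bayes_evidence prior (gpred T) half1 n (sample Xs w).
  by apply: le_trans ev_ge; rewrite ler_wpM2r ?expR_ge0.
have ev0 := lt_le_trans (mulr_gt0 (expR_gt0 _) (expR_gt0 _)) ev_ge2.
move: ev_ge2; rewrite -expRD -[leRHS]lnK ?posrE// ler_expR sumrB second_cst.
have lna : ln a <= a - 1.
  by have := @le_ln1Dx R (a - 1) ltac:(lra); rewrite addrC subrK.
have := ler_wpM2l (ltW N0) lna.
have h0 : 0 <= h (zpt T (kap T)).
  by rewrite hellinger_ge0// => j; exact: ltW.
have := kap_hellinger gT; have := ler_wpM2r h0 Nm; move: sumF.
rewrite /comp_rate -/a; move: (\sum_(t < n | _) _) (ln (bayes_evidence _ _ _ _ _)) => S E.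
move: (h _) => hz; rewrite !mulrBr mulr1 !mulrA; lra.
Qed.

(** The 9 is the 3 of the logarithmic inequality times the 3 of [n <= 3 * N]. *)
Let rate_bound : 9 * (L / eta + ((3 * M%:R + 2) + 2 * L + 5 * (eps + 1))) <=
  (870 * 10 ^+ 3 + 30) * M%:R + 45 * 10 ^+ 3 * ln M%:R * L.
Proof.
have M00 : 0 < M%:R :> R by rewrite ltr0n.
have lM : 1 / 2 <= ln M%:R :> R.
  apply: le_trans (le_oneBV_ln M00).
  have : (M%:R^-1 : R) <= 2^-1 by rewrite lef_pV2 ?posrE.
  by lra.
have l6 : ln 6 <= 5 :> R.
  by have := @le_ln1Dx R 5 ltac:(lra); rewrite (_ : 1 + 5 = 6)//; lra.
have lB : ln B <= 7 * ln M%:R.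
  rewrite mulr_natl -lnXn// ler_ln ?posrE ?exprn_gt0 ?mulr_gt0//.
  rewrite /B exprS mulrC ler_wpM2l ?(ltW M00)//.
  rewrite (_ : 64 = 2 ^+ 6); last by ring.
  by apply: lerXn2r; rewrite ?nnegrE.
have -> : L / eta = L * (12 + 6 * ln B) by rewrite /eta invrK.
have H1 : L * ln B <= L * (7 * ln M%:R) by rewrite ler_wpM2l.
have H2 : L * (1 / 2) <= L * ln M%:R by rewrite ler_wpM2l.
have H3 : M%:R * ln 6 <= M%:R * 5 :> R by rewrite ler_wpM2l// ltW.
by rewrite /eps lnD; exact: rate_constant.
Qed.

Let risk_bound w : good (sel w) -> Y factor (sel w) w <= A ->
  Y (fun T _ _ => comp T) (sel w) w <= A ->
  \int[Q]_y (- ln (bayes_average prior (gpred (sel w)) half1 (sample Xs w) y)) <=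
  ((870 * 10 ^+ 3 + 30) * M%:R + 45 * 10 ^+ 3 * ln M%:R * L) / n%:R.
Proof.
move=> gT H3 H4.
have H := ln_evidence_ge gT H4.
move: H3; rewrite /Y asboolT// => H3.
apply: le_trans (Rintegral_ln_average_le prior0 prior1 (mgpred (sel w)) (gpred1 (sel w)) B1
  (fun k y => gpredB k y gT) eta_B (first_half_lt n2) A0 _) _.
  apply: le_trans H3; rewrite le_eqVlt; apply/orP; left; apply/eqP.
  by apply: eq_bigr => t _; rewrite tnth_sample.
rewrite -/N ler_pdivlMr ?ltr0n//; apply: le_trans rate_bound.
have H' : ln A / eta - ln (bayes_evidence prior (gpred (sel w)) half1 n (sample Xs w)) <=
   L / eta + ((3 * M%:R + 2) + 2 * L + 5 * (eps + 1)) by rewrite lerD2l.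
have S0 : 0 <= L / eta + ((3 * M%:R + 2) + 2 * L + 5 * (eps + 1)).
  have l6 : 0 <= ln 6 :> R by apply: ln_ge0; rewrite ler1n.
  have e0 : 0 <= eps + 1.
    by rewrite /eps lnD; have := L0; have := mulr_ge0 (ler0n R M) l6; lra.
  have Le0 : 0 <= L / eta by rewrite /eta invrK mulr_ge0//; have := ln_ge0 B1; lra.
  by have := M2R; have := L0; lra.
apply: (@le_trans _ _ (3 / N * (L / eta + ((3 * M%:R + 2) + 2 * L + 5 * (eps + 1))) * n%:R)).
  by rewrite ler_wpM2r// ler_wpM2l// divr_ge0// ltW.
rewrite mulrAC ler_wpM2r// mulrAC ler_pdivrMr//; have := nN; lra.
Qed.

Let estimatorE w y : (forall i, pstar (Xs i w) != 0) -> pstar y != 0 ->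
  estimator delta p M2 (sample Xs w) y =
  pstar y * bayes_average prior (gpred (sel w)) half1 (sample Xs w) y.
Proof.
move=> pw py; rewrite /estimator ifT; last first.
  apply/forallP => i; rewrite tnth_sample gt_eqF//.
  apply: (@lt_le_trans _ _ (pstar (Xs i w))); first by rewrite lt_def pw pstar0.
  apply: le_mixture => // j; rewrite -theta1 (bigD1 j)//= lerDl.
  by rewrite sumr_ge0.
rewrite /bayes_average mulrA mulr_sumr; congr (_ / _); apply: eq_bigr => t _.
apply: bayes_predictive_scale => // [k z pz|i].
  by rewrite /net_density mixture_f// /gpred mulrA.
by rewrite tnth_sample.
Qed.

Let KL_estimator_le w : (forall i, pstar (Xs i w) != 0) -> good (sel w) ->
  Y factor (sel w) w <= A -> Y (fun T _ _ => comp T) (sel w) w <= A ->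
  (KL mu pstar (estimator delta p M2 (sample Xs w)) <=
   (((870 * 10 ^+ 3 + 30) * M%:R + 45 * 10 ^+ 3 * ln M%:R * L) / n%:R)%:E)%E.
Proof.
move=> pw gT H3 H4.
pose avg := bayes_average prior (gpred (sel w)) half1 (sample Xs w).
have gB k y : B^-1 <= gpred (sel w) k y by exact: gpredB.
have avgB y : B^-1 <= avg y := average_ge prior0 prior1 B1 gB (first_half_lt n2) _ y.
have B0 : 0 < B := lt_le_trans ltr01 B1.
have avg0 y : 0 < avg y by apply: lt_le_trans (avgB y); rewrite invr_gt0.
have [me e0 _] := estimator_is_density delta hp M2 n2 (sample Xs w).
(* The uniform lower bound on [avg] yields [pstar <= B * estimator] pointwise, hence absolute
   continuity whatever the supports of the components. *)
rewrite /KL asboolT; last first.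
  apply: (@density_law_dominates _ _ _ _ _ _ B) => //; first exact: ltW.
  move=> y; have [->|py] := eqVneq (pstar y) 0; first by rewrite mulr_ge0// ltW.
  rewrite estimatorE// -/avg mulrCA ler_peMr//.
  by rewrite -ler_pdivrMl// mulr1.
have -> : (\int[mu]_x (pstar x * ln (pstar x / estimator delta p M2 (sample Xs w) x))%:E =
    \int[mu]_x (- ln (avg x) * pstar x)%:E)%E.
  apply: eq_integral => y _; congr EFin.
  have [->|py] := eqVneq (pstar y) 0; first by rewrite mul0r mulr0.
  by rewrite estimatorE// -/avg invfM mulrA mulfV// mul1r lnV ?posrE// mulrC.
have iavg : Q.-integrable setT (EFin \o (fun y => - ln (avg y))).
  apply: integrable_opp.
  exact: (integrable_ln_average prior0 prior1 (mgpred (sel w)) (gpred1 (sel w)) B1 gB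
    (first_half_lt n2)).
rewrite (integral_density mpstar pstar0 Qpstar iavg).
rewrite -(fineK (integrable_fin_num measurableT iavg)) lee_fin.
exact: risk_bound.
Qed.

(** * Failure events and their probabilities *)

Let markov_A (S : Omega -> R) c : 0 < c -> measurable_fun setT S ->
  (forall w, 0 <= S w) -> (\int[P]_w (S w)%:E <= c%:E)%E ->
  measurable [set w | A * c < S w] /\ (P [set w | (A * c < S w)%R] <= (A^-1)%:E)%E.
Proof.
move=> c0 mS S0 Sc; split; first exact: measurable_set_lt.
have -> : A^-1 = c / (A * c) by rewrite [(A * c)^-1]invfM mulrCA (mulfV (lt0r_neq0 c0)) mulr1.
by apply: markov_ge => //; exact: mulr_gt0.
Qed.

Let W0 : 0 < W.
Proof.
rewrite /lattice_weight (bigD1 k0)//= ltr_pwDl ?expR_gt0//.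
by apply: sumr_ge0 => k _; exact: expR_ge0.
Qed.

Let bad1 := [set w | A * (expR (1 / 4) * 6 ^+ M * W) < lik_sum Xs Q f first mesh w].
Let bad2 := [set w | A * (expR (1 / 3) * W) < inv_lik_sum Xs Q f first k0 w].

Let bad1P : measurable bad1 /\ (P bad1 <= (A^-1)%:E)%E.
Proof.
apply: markov_A.
- by rewrite !mulr_gt0 ?expR_gt0 ?exprn_gt0.
- exact: measurable_lik_sum.
- by move=> w; exact: lik_sum_ge0.
- apply: le_trans (integral_lik_sum lawQ indep mf f0 f1 first mesh) _.
  rewrite lee_fin; exact: (lattice_weight_refine mf f0 f1 mesh0 m_mesh (isT : 0 < 6)%N).
Qed.

Let bad2P : measurable bad2 /\ (P bad2 <= (A^-1)%:E)%E.
Proof.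
apply: markov_A.
- by rewrite mulr_gt0 ?expR_gt0.
- exact: measurable_inv_lik_sum.
- by move=> w; exact: inv_lik_sum_ge0.
- exact: (integral_inv_lik_sum lawQ indep mf f0 f1 mesh0 m_mesh k0_ge1 k0_mass).
Qed.

Let good0 : set Omega := \bigcap_i (Xs i @^-1` (~` [set x | pstar x = 0])).

Let mZ : measurable (~` [set x | pstar x = 0]).
Proof.
apply: measurableC.
by have := mpstar measurableT (measurable_set1 (0 : R)); rewrite setTI.
Qed.

Let mgood0 : measurable good0.
Proof.
apply: fin_bigcap_measurable => [|i _]; first exact: finite_finset.
by rewrite -[X in measurable X]setTI; exact: measurable_funP.
Qed.

Let P_good0 : P good0 = 1%E.
Proof.
rewrite indep// big1// => i _; rewrite lawQ//.
rewrite probability_setC; last by rewrite -[X in measurable X]setCK; exact: measurableC.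
by rewrite (density_null_set mpstar Qpstar) sube0.
Qed.

Lemma estimator_risk : with_probability_ge P (1 - delta)
  [set w | (KL mu pstar (estimator delta p M2 (sample Xs w)) <=
   (((870 * 10 ^+ 3 + 30) * M%:R + 45 * 10 ^+ 3 * ln M%:R * ln (4 / delta)) / n%:R)%:E)%E].
Proof.
have [m1 P1] := bad1P; have [m2 P2] := bad2P; have [m3 P3] := bad3; have [m4 P4] := bad4.
set b3 := [set w | _] in m3 P3; set b4 := [set w | _] in m4 P4.
pose bad := ~` good0 `|` (bad1 `|` bad2 `|` (b3 `|` b4)).
have mbad : measurable bad.
  by apply: measurableU; [exact: measurableC|apply: measurableU; exact: measurableU].
exists (~` bad); split.
- exact: measurableC.
- move=> w /not_orP[/contrapT g0 /not_orP[/not_orP[n1 n2'] /not_orP[n3 n4]]].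
  have le_of (x y : R) : ~ (x < y) -> y <= x by move=> /negP; rewrite -leNgt.
  have pw i : pstar (Xs i w) != 0 by apply/eqP; exact: g0.
  apply: KL_estimator_le => //; try exact: le_of.
  by apply: good_likely_set => //; exact: le_of.
rewrite probability_setC// EFinB; apply: leeB => //.
(* The 0 accounts for samples meeting the zero set of the truth, the other terms for the four Markov
   bounds. *)
have -> : delta%:E = (0 + (A^-1%:E + A^-1%:E + (A^-1%:E + A^-1%:E)))%E.
  by rewrite add0e -!EFinD; congr EFin; rewrite /fail_ratio invfM invrK; field.
have U2 (S T : set Omega) b c : measurable S -> measurable T ->
    (P S <= b -> P T <= c -> P (S `|` T) <= b + c)%E.
  by move=> mS mT Sb Tc; apply: le_trans (leeD Sb Tc); exact: measureU2.
have m12 : measurable (bad1 `|` bad2) by exact: measurableU.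
have m34 : measurable (b3 `|` b4) by exact: measurableU.
apply: (U2); [exact: measurableC|exact: measurableU| |].
  by rewrite probability_setC// P_good0 subee.
by apply: (U2) => //; exact: (U2).
Qed.

End analysis.

(* MathComp-Analysis.  870 * 10 ^+ 3 + 30 is 870030 and 45 * 10 ^+ 3 is 45000:
   ring literals are unary and overflow at that size. *)
Theorem theorem6 (R : realType) (M n : nat) (hM : (2 <= M)%N) (hn : (2 <= n)%N)
    (delta : R) (hdelta0 : 0 < delta) (hdelta1 : delta < 1)
    (d : measure_display) (X : measurableType d)
    (mu : {measure set X -> \bar R})
    (p : 'I_M -> X -> R) (hp : forall j : 'I_M, is_density mu (p j)) :
  exists phat : ('I_n -> X) -> X -> R,
    is_density_estimator mu phat /\
    forall pstar : X -> R, mixtures p pstar ->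
    forall (d' : measure_display) (Omega : measurableType d')
      (P : probability Omega R) (Xs : 'I_n -> {RV P >-> X}),
    iid_with_density mu Xs pstar ->
    with_probability_ge P (1 - delta)
      [set omega : Omega |
        (KL mu pstar (phat (fun i : 'I_n => Xs i omega)) <=
         (((870 * 10 ^+ 3 + 30) * M%:R
           + 45 * 10 ^+ 3 * ln M%:R * ln (4 / delta)) / n%:R)%:E)%E].
Proof.
exists (fun s => estimator delta p hM [tuple s i | i < n]); split.
  by move=> s; exact: estimator_is_density.
move=> pstar [theta [theta0 theta1 ->]] d' Omega P Xs iid.
exact: (estimator_risk hp hM hn hdelta0 hdelta1 theta0 theta1 iid).
Qed.
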